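(* Let $G^{2n+2}$ be a commutative Lie group of dimension $2n+2$ with a left invariant metric, and let $M^{2n+1}$ be a compact, connected and oriented immersed hypersurface of $G^{2n+2}$. If $M$ is not parallelisable, then $M$ does not admit transversely orientable codimension-one foliations with totally geodesic leaves.
   Context: All manifolds, maps and foliations are smooth; compact manifolds are without boundary. $M$ carries the Riemannian metric induced by the immersion into $G$, and a leaf of a codimension-one foliation of $M$ is totally geodesic if it is a totally geodesic submanifold of $M$ (equivalently, its shape operator in the direction of a unit vector field tangent to $M$ and normal to the leaves vanishes). *)

(* Defs.v *)
From HB Require Import structures.
From mathcomp Require Import all_boot all_order all_algebra.
From mathcomp Require Import all_classical all_reals all_analysis.

Set Implicit Arguments.
Unset Strict Implicit.
Unset Printing Implicit Defensive.

Import Order.TTheory GRing.Theory Num.Theory.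
Import numFieldNormedType.Exports.

Local Open Scope classical_set_scope.
Local Open Scope ring_scope.

(* All uses below are on open sets U of finite-dimensional spaces. *)
Fixpoint Ck_on (R : realType) (V W : normedModType R) (k : nat)
    (U : set V) (f : V -> W) : Prop :=
  match k with
  | 0 => forall x, U x -> {for x, continuous f}
  | k'.+1 => (forall x, U x -> differentiable f x) /\
             (forall v : V, Ck_on k' U ('D_v f))
  end.

Definition smooth_on (R : realType) (V W : normedModType R)
    (U : set V) (f : V -> W) : Prop := forall k, Ck_on k U f.

(* A homeomorphism from the open set [dom] onto the open set [cod]; the values
   of [coord] outside [dom] and of [param] outside [cod] are irrelevant. *)
Record chart (R : realType) (T : topologicalType) (m : nat) := Chart {
  dom : set T ;
  cod : set 'rV[R]_m ;
  coord : T -> 'rV[R]_m ;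
  param : 'rV[R]_m -> T ;
  open_dom : open dom ;
  open_cod : open cod ;
  coord_cod : forall p, dom p -> cod (coord p) ;
  param_dom : forall u, cod u -> dom (param u) ;
  coordK : forall p, dom p -> param (coord p) = p ;
  paramK : forall u, cod u -> coord (param u) = u ;
  coord_continuous : forall p, dom p -> {for p, continuous coord} ;
  param_continuous : forall u, cod u -> {for u, continuous param} }.

Section LocalRep.
Variables (R : realType) (T S : topologicalType) (m p : nat).
Variables (f : T -> S) (c : chart R T m) (d : chart R S p).

Definition local_rep (u : 'rV[R]_m) : 'rV[R]_p := coord d (f (param c u)).

Definition local_dom : set 'rV[R]_m :=
  [set u | cod c u /\ dom d (f (param c u))].

End LocalRep.

Section Transition.
Variables (R : realType) (T : topologicalType) (m : nat).

Definition transition (c d : chart R T m) : 'rV[R]_m -> 'rV[R]_m :=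
  local_rep id c d.

Definition overlap (c d : chart R T m) : set 'rV[R]_m := local_dom id c d.

Definition compatible (c d : chart R T m) : Prop :=
  smooth_on (overlap c d) (transition c d) /\
  smooth_on (overlap d c) (transition d c).

(* An [m]-dimensional smooth manifold structure on [T], as a maximal atlas. *)
Record smooth_manifold := SmoothManifold {
  atlas : set (chart R T m) ;
  manifold_hausdorff : hausdorff_space T ;
  manifold_second_countable : @second_countable T ;
  atlas_cover : forall p, exists2 c, atlas c & dom c p ;
  atlas_compatible : forall c d, atlas c -> atlas d -> compatible c d ;
  atlas_maximal : forall c, (forall d, atlas d -> compatible c d) -> atlas c }.

End Transition.

Section Maps.
Variables (R : realType) (T S : topologicalType) (m p : nat).
Variables (A : smooth_manifold R T m) (B : smooth_manifold R S p).

Definition smooth_map (f : T -> S) : Prop :=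
  continuous f /\
  forall c d, atlas A c -> atlas B d ->
    smooth_on (local_dom f c d) (local_rep f c d).

(* ['J h u] acts on row vectors by right multiplication, so that [row_free]
   says that the differential is injective. *)
Definition immersion (f : T -> S) : Prop :=
  smooth_map f /\
  forall c d u, atlas A c -> atlas B d -> local_dom f c d u ->
    row_free ('J (local_rep f c d) u).

End Maps.

Section Tensors.
Variables (R : realType) (T : topologicalType) (m : nat).
Variable A : smooth_manifold R T m.

(* Tensor fields are given by their components in every chart of the atlas, as
   functions of the coordinates, subject to the transformation rule. *)
Definition vector_field (U : set T)
    (X : chart R T m -> 'rV[R]_m -> 'rV[R]_m) : Prop :=
  (forall c, atlas A c ->
     smooth_on [set u | cod c u /\ U (param c u)] (X c)) /\
  (forall c d u, atlas A c -> atlas A d -> overlap c d u -> U (param c u) ->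
     X d (transition c d u) = X c u *m 'J (transition c d) u).

Definition parallelisable : Prop :=
  exists X : 'I_m -> chart R T m -> 'rV[R]_m -> 'rV[R]_m,
    (forall i, vector_field setT (X i)) /\
    (forall c u, atlas A c -> cod c u -> row_free (\matrix_i X i c u)).

Record orientation := Orientation {
  oriented_charts : set (chart R T m) ;
  oriented_sub : oriented_charts `<=` atlas A ;
  oriented_cover : forall p, exists2 c, oriented_charts c & dom c p ;
  oriented_det : forall c d u, oriented_charts c -> oriented_charts d ->
    overlap c d u -> 0 < \det ('J (transition c d) u) }.

Record riemannian_metric := RiemannianMetric {
  gram :> chart R T m -> 'rV[R]_m -> 'M[R]_m ;
  gram_smooth : forall c, atlas A c -> smooth_on (cod c) (gram c) ;
  gram_sym : forall c u, atlas A c -> cod c u -> (gram c u)^T = gram c u ;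
  gram_posdef : forall c u (X : 'rV[R]_m), atlas A c -> cod c u -> X != 0 ->
    0 < (X *m gram c u *m X^T) 0 0 ;
  gram_change : forall c d u, atlas A c -> atlas A d -> overlap c d u ->
    gram c u = 'J (transition c d) u *m gram d (transition c d u)
                 *m ('J (transition c d) u)^T }.

Variable g : riemannian_metric.

Definition inner (c : chart R T m) (u X Y : 'rV[R]_m) : R :=
  (X *m g c u *m Y^T) 0 0.

Definition dgram (c : chart R T m) (u : 'rV[R]_m) (i j l : 'I_m) : R :=
  'D_(delta_mx 0 i) (fun v => g c v j l) u.

(* The Christoffel symbol with lower indices i, j and upper index k of the
   Levi-Civita connection. *)
Definition christoffel (c : chart R T m) (u : 'rV[R]_m) (i j k : 'I_m) : R :=
  2^-1 * \sum_l invmx (g c u) k l *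
           (dgram c u i j l + dgram c u j i l - dgram c u l i j).

Definition covariant_derivative (c : chart R T m) (u X : 'rV[R]_m)
    (N : chart R T m -> 'rV[R]_m -> 'rV[R]_m) : 'rV[R]_m :=
  'D_X (N c) u +
  \row_k \sum_i \sum_j christoffel c u i j k * X 0 i * N c u 0 j.

End Tensors.

Definition isometric (R : realType) (T S : topologicalType) (m p : nat)
    (A : smooth_manifold R T m) (B : smooth_manifold R S p)
    (gA : riemannian_metric A) (gB : riemannian_metric B) (f : T -> S) : Prop :=
  forall c d u, atlas A c -> atlas B d -> local_dom f c d u ->
    gA c u = 'J (local_rep f c d) u *m gB d (local_rep f c d u)
               *m ('J (local_rep f c d) u)^T.

(* A commutative Lie group is written additively; commutativity is part of the
   [zmodType] structure. *)
Section LieGroup.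
Variables (R : realType) (G : topologicalZmodType) (m : nat).
Variable A : smooth_manifold R G m.

Definition commutative_lie_group : Prop :=
  (forall c d e, atlas A c -> atlas A d -> atlas A e ->
     smooth_on
       [set w : 'rV[R]_m * 'rV[R]_m | cod c w.1 /\ cod d w.2 /\
          dom e (param c w.1 + param d w.2)]
       (fun w => coord e (param c w.1 + param d w.2))) /\
  smooth_map A A (fun x : G => - x).

Definition left_invariant (g : riemannian_metric A) : Prop :=
  forall a : G, isometric g g (fun x : G => a + x).

End LieGroup.

Section Foliation.
Variables (R : realType) (T : topologicalType) (k : nat).
Variable A : smooth_manifold R T k.+1.

(* The last coordinate is the transverse one: changes of foliated charts have
   the local form (x, y) |-> (f(x, y), h(y)). *)
Definition foliated_change (c d : chart R T k.+1) : Prop :=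
  forall u, overlap c d u ->
    exists h : R -> R,
      \forall v \near u, transition c d v 0 ord_max = h (v 0 ord_max).

(* A codimension-one foliation, as a maximal foliated atlas; its leaves are
   obtained by glueing the plaques, i.e. the level sets of the last coordinate
   of the foliated charts. *)
Record foliation := Foliation {
  foliated_charts : set (chart R T k.+1) ;
  foliated_sub : foliated_charts `<=` atlas A ;
  foliated_cover : forall p, exists2 c, foliated_charts c & dom c p ;
  foliated_compatible : forall c d, foliated_charts c -> foliated_charts d ->
    foliated_change c d ;
  foliated_maximal : forall c, atlas A c ->
    (forall d, foliated_charts d -> foliated_change c d /\ foliated_change d c) ->
    foliated_charts c }.

(* The coefficient of the Jacobian matrix is the derivative h' above. *)
Definition transversely_orientable (F : foliation) : Prop :=
  exists O : set (chart R T k.+1),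
    [/\ O `<=` foliated_charts F,
        (forall p, exists2 c, O c & dom c p) &
        (forall c d u, O c -> O d -> overlap c d u ->
           0 < 'J (transition c d) u ord_max ord_max)].

(* Tangency to the leaf through [param c u]. *)
Definition tangent_to_leaf (F : foliation) (c : chart R T k.+1)
    (u X : 'rV[R]_k.+1) : Prop :=
  forall d, foliated_charts F d -> overlap c d u ->
    (X *m 'J (transition c d) u) 0 ord_max = 0.

Definition unit_normal_field (g : riemannian_metric A) (F : foliation)
    (U : set T) (N : chart R T k.+1 -> 'rV[R]_k.+1 -> 'rV[R]_k.+1) : Prop :=
  vector_field A U N /\
  forall c u, atlas A c -> cod c u -> U (param c u) ->
    inner g c u (N c u) (N c u) = 1 /\
    (forall X, tangent_to_leaf F c u X -> inner g c u (N c u) X = 0).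

(* Since N has unit length, the covariant derivative of N is tangent to the
   leaf, so no projection is needed. *)
Definition shape_operator (g : riemannian_metric A)
    (N : chart R T k.+1 -> 'rV[R]_k.+1 -> 'rV[R]_k.+1)
    (c : chart R T k.+1) (u X : 'rV[R]_k.+1) : 'rV[R]_k.+1 :=
  - covariant_derivative g c u X N.

(* The normal field is only local, so that the notion makes sense for foliations
   that are not transversely orientable. *)
Definition totally_geodesic_leaves (g : riemannian_metric A)
    (F : foliation) : Prop :=
  forall (U : set T) N, open U -> unit_normal_field g F U N ->
    forall c u X, atlas A c -> cod c u -> U (param c u) ->
      tangent_to_leaf F c u X -> shape_operator g N c u X = 0.

End Foliation.

(* Main.v *)
(* Translations trivialise the tangent bundle of the group [G], so vectors
   tangent to [M] become vectors of the Euclidean space T_0 G, and both the unit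
   normal [eta] of the hypersurface and the unit normal [N] of the foliation are
   maps from [M] to the unit sphere of T_0 G.  Because [G] is commutative, the
   trivialisation is flat, and the Levi-Civita connection of [M] is the
   tangential part of the ordinary derivative.  If the leaves are totally
   geodesic, the derivative of [N] along a leaf is therefore a multiple of [eta],
   and [N] has rank at most 2.  In dimension at least 3 the easy case of Sard's
   theorem (a C^1 map between spaces of equal dimension, all of whose points are
   critical) gives a point [a] of the sphere that [N] misses.  The reflection
   exchanging [a] and [N p], followed by the one exchanging [N p] and [eta p],
   depends smoothly on [p] and maps the fixed hyperplane orthogonal to [a] onto
   the tangent space at [p]: a basis of that hyperplane becomes a global frame.
   In dimension 1, [N] itself is a frame. *)

From HB Require Import structures.
From mathcomp Require Import all_boot all_order all_algebra.
From mathcomp Require Import all_classical all_reals all_analysis.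
From mathcomp Require Import ring lra zify.
Require Import Defs.

Set Implicit Arguments.
Unset Strict Implicit.
Unset Printing Implicit Defensive.

Import Order.TTheory GRing.Theory Num.Theory.
Import numFieldNormedType.Exports.

Local Open Scope classical_set_scope.
Local Open Scope ring_scope.

(** * Calculus of smooth functions *)

(** The reflection exchanging [a] and [N p] is built from [N p - a], which must never vanish: this
    is why a missed point is wanted. The second reflection is always defined, because [N p] and
    [eta p] are orthogonal unit vectors. In the rank bound, 1 stands for the normal line to [M],
    which contains all derivatives of [N] along the leaves, and 1 for the single transverse
    derivative. The sphere lies in a space of one dimension more than [M], so the Sard argument is
    applied to [N] followed by the projection that forgets the first coordinate. The missed value is
    sought in a small cube at the origin, since every point of such a cube lifts to the sphere. The
    orientation of [M] and the transverse orientation of the foliation enter in the same way: they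
    make the normals computed in different charts agree up to positive factors, so that normalising
    them gives global fields. *)

Lemma near_eq_differentiable (R : realType) (V W : normedModType R)
    (f g : V -> W) (x : V) :
  (\near x, f x = g x) -> differentiable f x -> differentiable g x.
Proof.
(* It suffices to treat [h], which vanishes near [x] and so has differential 0 there. *)
move=> fg df; pose h := g - f.
have hx0 : h x = 0 by rewrite -[LHS]/(g x - f x) (nbhs_singleton fg) subrr.
have -> : g = f + h by rewrite /h addrC subrK.
apply: differentiableD => //.
have key : h \o shift x = cst (h x) + (0 : V -> W) +o_ 0 id.
  apply/eqaddoP => _/posnumP[e]; rewrite hx0 addr0.
  have fg0 : \forall y \near (0 : V), f (y + x) = g (y + x).
    by move: fg; rewrite (near_shift 0) /=; apply: filterS => y /=; rewrite subr0.
  near=> y.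
  have -> : (h \o shift x - cst 0) y = 0.
    rewrite -[LHS]/(g (y + x) - f (y + x) - 0) subr0 (near fg0 y) //.
    by rewrite subrr.
  by rewrite normr0 mulr_ge0.
have d0 : 'd h x = 0 :> (V -> W).
  by apply/diff_unique => // ?; exact: cvg_cst.
apply/diff_locallyP; rewrite d0; split => // ?; exact: cvg_cst.
Unshelve. all: by end_near. Qed.

Lemma near_open (T : topologicalType) (U : set T) (P : T -> Prop) (x : T) :
  open U -> U x -> (forall y, U y -> P y) -> \forall y \near x, P y.
Proof.
by move=> oU Ux UP; apply: filterS UP _; apply: open_nbhs_nbhs; split.
Qed.

Section Ck.
Variable R : realType.
Implicit Types V W : normedModType R.

Lemma Ck_on_sub V W k (U U' : set V) (f : V -> W) :
  U' `<=` U -> Ck_on k U f -> Ck_on k U' f.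
Proof.
elim: k f => [|k IH] f sU /=; first by move=> H x /sU/H.
by move=> [df Df]; split => [x /sU/df//|v]; exact: IH.
Qed.

(** The derivatives ['D_v f] are functions on the whole space, so every clause of [Ck_on] is a
    condition at single points of [U]. This makes smoothness a local property. *)
Lemma Ck_on_pointwise V W k (U : set V) (f : V -> W) :
  (forall x, U x -> Ck_on k [set x] f) -> Ck_on k U f.
Proof.
elim: k f => [|k IH] f /= H; first by move=> x /H; exact.
split=> [x /H [df _]|v]; first exact: df.
by apply: IH => x /H [_]; exact.
Qed.

Lemma smooth_on_sub V W (U U' : set V) (f : V -> W) :
  U' `<=` U -> smooth_on U f -> smooth_on U' f.
Proof. by move=> sU H k; exact: Ck_on_sub (H k). Qed.

Lemma smooth_on_local V W (U : set V) (f : V -> W) :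
  (forall x, U x -> exists2 U', U' x & smooth_on U' f) -> smooth_on U f.
Proof.
move=> H k; apply: Ck_on_pointwise => x /H[U' U'x sf].
by apply: Ck_on_sub (sf k) => _ ->.
Qed.

(** The openness assumptions of this part come from here: an equality passes to derivatives only if
    it holds in a neighbourhood, and each closure property below replaces a derivative by its
    formula on [U]. *)
Lemma Ck_on_ext V W k (U : set V) (f g : V -> W) : open U ->
  (forall x, U x -> f x = g x) -> Ck_on k U f -> Ck_on k U g.
Proof.
move=> oU; elim: k f g => [|k IH] f g fg /=.
  move=> H x Ux; rewrite /prop_for /continuous_at -(fg x Ux).
  apply: cvg_trans (H x Ux); apply: near_eq_cvg.
  by apply: near_open Ux _ => // y; exact: fg.
have nfg x : U x -> \near x, f x = g x by move=> Ux; exact: near_open Ux fg.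
move=> [df Df]; split=> [x Ux|v].
  by apply: near_eq_differentiable (nfg x Ux) _; exact: df.
apply: IH (Df v) => x Ux; exact: near_eq_derive (nfg x Ux).
Qed.

Lemma smooth_on_ext V W (U : set V) (f g : V -> W) : open U ->
  (forall x, U x -> f x = g x) -> smooth_on U f -> smooth_on U g.
Proof. by move=> oU fg H k; exact: Ck_on_ext (H k). Qed.

Lemma Ck_onW V W k (U : set V) (f : V -> W) : Ck_on k.+1 U f -> Ck_on k U f.
Proof.
elim: k f => [|k IH] f.
  by move=> [df _] x Ux; apply: differentiable_continuous; exact: df.
by move=> [df Df]; split => // v; apply: IH.
Qed.

Lemma smooth_on_differentiable V W (U : set V) (f : V -> W) x :
  smooth_on U f -> U x -> differentiable f x.
Proof. by move=> /(_ 1%N)[df _]; exact: df. Qed.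

Lemma smooth_on_derive V W (U : set V) (f : V -> W) v :
  smooth_on U f -> smooth_on U ('D_v f).
Proof. by move=> H k; have [_] := H k.+1; exact. Qed.

Lemma smooth_on_continuous V W (U : set V) (f : V -> W) x :
  smooth_on U f -> U x -> {for x, continuous f}.
Proof. by move=> /(_ 0%N); exact. Qed.

Lemma Ck_on_cst V W k (U : set V) (a : W) : Ck_on k U (fun=> a).
Proof.
elim: k a => [|k IH] a /=; first by move=> x _; exact: cvg_cst.
split=> [x _|v]; first exact: differentiable_cst.
rewrite (_ : 'D_v _ = fun=> 0); first exact: IH.
by apply/funext => x; exact: derive_cst.
Qed.

Lemma Ck_onD V W k (U : set V) (f g : V -> W) : open U ->
  Ck_on k U f -> Ck_on k U g -> Ck_on k U (fun x => f x + g x).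
Proof.
move=> oU; elim: k f g => [|k IH] f g /=.
  by move=> cf cg x Ux; apply: continuousD; [exact: cf|exact: cg].
move=> [df Df] [dg Dg]; split=> [x Ux|v].
  by apply: differentiableD; [exact: df|exact: dg].
apply: (@Ck_on_ext _ _ _ _ (fun x => 'D_v f x + 'D_v g x)) => //.
  move=> x Ux; rewrite -[fun y => _]/(f + g) deriveD //.
    by apply: diff_derivable; exact: df.
  by apply: diff_derivable; exact: dg.
exact: IH.
Qed.

Lemma derive_linear_comp V W W' (l : {linear W -> W'}) (f : V -> W) x v :
  continuous l -> differentiable f x ->
  'D_v (fun y => l (f y)) x = l ('D_v f x).
Proof.
move=> cl df; have dl := @linear_differentiable _ _ _ l (f x) (@cl).
rewrite !deriveE //; last exact: (differentiable_comp df dl).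
by rewrite (diff_comp df dl) /= diff_lin.
Qed.

Lemma Ck_on_linear_comp V W W' k (U : set V) (l : {linear W -> W'})
    (f : V -> W) : open U -> continuous l ->
  Ck_on k U f -> Ck_on k U (fun x => l (f x)).
Proof.
move=> oU cl; elim: k f => [|k IH] f /=.
  by move=> cf x Ux; apply: continuous_comp; [exact: cf|exact: cl].
move=> [df Df]; split=> [x Ux|v].
  have dl := @linear_differentiable _ _ _ l (f x) (@cl).
  by apply: (differentiable_comp (df x Ux) dl).
apply: (@Ck_on_ext _ _ _ _ (fun x => l ('D_v f x))) => //.
  by move=> x Ux; rewrite derive_linear_comp //; exact: df.
exact: IH.
Qed.

Lemma Ck_onM V k (U : set V) (f g : V -> R) : open U ->
  Ck_on k U f -> Ck_on k U g -> Ck_on k U (fun x => f x * g x).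
Proof.
move=> oU; elim: k f g => [|k IH] f g.
  by move=> cf cg x Ux; apply: continuousM; [exact: cf|exact: cg].
move=> cf cg; have [df Df] := cf; have [dg Dg] := cg; split=> [x Ux|v].
  by apply: differentiableM; [exact: df|exact: dg].
apply: (@Ck_on_ext _ _ _ _ (fun x => f x * 'D_v g x + g x * 'D_v f x)) => //.
  move=> x Ux; rewrite -[fun y => _]/(f * g) deriveM //.
    by apply: diff_derivable; exact: df.
  by apply: diff_derivable; exact: dg.
apply: Ck_onD => //; apply: IH.
- exact: Ck_onW cf.
- exact: Dg.
- exact: Ck_onW cg.
- exact: Df.
Qed.

Lemma Ck_on_id V k (U : set V) : Ck_on k U id.
Proof.
case: k => [|k] /=; first by move=> x _ A.
split=> // v; rewrite (_ : 'D_v _ = fun=> v); first exact: Ck_on_cst.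
by apply/funext => x; rewrite derive_id.
Qed.

Lemma Ck_on_sum V W k (U : set V) (I : Type) (r : seq I) (P : pred I)
    (F : I -> V -> W) : open U ->
  (forall i, P i -> Ck_on k U (F i)) ->
  Ck_on k U (fun x => \sum_(i <- r | P i) F i x).
Proof.
move=> oU H; elim: r => [|i r IH].
  apply: (@Ck_on_ext _ _ _ _ (cst 0)) => // [x _|]; first by rewrite big_nil.
  exact: Ck_on_cst.
apply: (@Ck_on_ext _ _ _ _
    (fun x => (if P i then F i x else 0) + \sum_(j <- r | P j) F j x)) => //.
  by move=> x _; rewrite big_cons; case: ifP => //; rewrite add0r.
apply: Ck_onD => //; case Pi: (P i); first exact: H.
exact: Ck_on_cst.
Qed.

Lemma Ck_on_prod V k (U : set V) (I : Type) (r : seq I)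
    (F : I -> V -> R) : open U ->
  (forall i, Ck_on k U (F i)) ->
  Ck_on k U (fun x => \prod_(i <- r) F i x).
Proof.
move=> oU H; elim: r => [|i r IH].
  have ext := @Ck_on_ext V R k U (cst 1); apply: ext => // [x _|]; first by rewrite big_nil.
  exact: Ck_on_cst.
apply: (@Ck_on_ext _ _ _ _
    (fun x => F i x * \prod_(j <- r) F j x)) => //.
  by move=> x _; rewrite big_cons.
exact: Ck_onM.
Qed.

Lemma Ck_onV V k (U : set V) (f : V -> R) : open U ->
  (forall x, U x -> f x != 0) ->
  Ck_on k U f -> Ck_on k U (fun x => (f x)^-1).
Proof.
move=> oU f0; elim: k => [|k IH].
  move=> cf x Ux; apply: cvgV; [exact: f0|exact: cf].
move=> cf; have [df Df] := cf; split=> [x Ux|v].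
  by apply: differentiableV; [exact: df|exact: f0].
apply: (@Ck_on_ext _ _ _ _
    (fun x => -1 * ((f x)^-1 * (f x)^-1 * 'D_v f x))) => //.
  move=> x Ux; rewrite deriveV ?f0 //; last by apply: diff_derivable; exact: df.
  by rewrite mulN1r expr2 invfM scaleNr.
have cV := IH (Ck_onW cf).
do !apply: Ck_onM => //; [exact: Ck_on_cst|exact: Df].
Qed.

Lemma Ck_on_sqrt V k (U : set V) (f : V -> R) : open U ->
  (forall x, U x -> 0 < f x) ->
  Ck_on k U f -> Ck_on k U (fun x => Num.sqrt (f x)).
Proof.
move=> oU f0.
have dsq x : U x -> differentiable (Num.sqrt : R -> R) (f x).
  by move=> /f0 /is_derive1_sqrt [dv _]; apply/derivable1_diffP.
elim: k => [|k IH].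
  move=> cf x Ux; apply: continuous_comp; first exact: cf.
  exact: sqrt_continuous.
move=> cf; have [df Df] := cf; split=> [x Ux|v].
  by apply: (differentiable_comp (df x Ux)); exact: dsq.
apply: (@Ck_on_ext _ _ _ _
    (fun x => (2 * Num.sqrt (f x))^-1 * 'D_v f x)) => //.
  move=> x Ux; have dc := differentiable_comp (df x Ux) (dsq x Ux).
  rewrite [RHS](deriveE _ dc) (diff_comp (df x Ux) (dsq x Ux)) /=.
  rewrite [in LHS](deriveE _ (df x Ux)).
  have [_ <-] := is_derive1_sqrt (f0 _ Ux).
  rewrite (deriveE _ (dsq x Ux)) -[X in _ = _ _ X]mulr1.
  by rewrite -[X in _ = _ _ X]/('d f x v *: (1 : R)) linearZ mulrC.
apply: Ck_onM; rewrite //; last exact: Df.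
apply: Ck_onV => // [x Ux|].
  by rewrite mulf_neq0 ?pnatr_eq0 // gt_eqF // sqrtr_gt0 f0.
apply: Ck_onM => //; first exact: Ck_on_cst.
by apply: IH; exact: Ck_onW.
Qed.

End Ck.

Definition mxcoord (R : realType) (m n : nat) (i : 'I_m) (j : 'I_n)
  (A : 'M[R]_(m, n)) : R := A i j.

Lemma mxcoord_linear (R : realType) (m n : nat) (i : 'I_m) (j : 'I_n) :
  linear (@mxcoord R m n i j).
Proof. by move=> a A B; rewrite /mxcoord !mxE. Qed.

HB.instance Definition _ (R : realType) (m n : nat) (i : 'I_m) (j : 'I_n) :=
  GRing.isLinear.Build R 'M[R]_(m, n) R _ (@mxcoord R m n i j)
    (@mxcoord_linear R m n i j).

Lemma mxcoord_continuous (R : realType) (m n : nat) (i : 'I_m) (j : 'I_n) :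
  continuous (@mxcoord R m n i j).
Proof. exact: (@matrix_normedtype.coord_continuous R m n i j). Qed.

Section CkComp.
Variable R : realType.
Implicit Types V W : normedModType R.

Section Basis.
Variables (V W : normedModType R) (I : finType).
Variables (b : I -> W) (l : I -> {linear W -> R}).
Hypothesis l_continuous : forall i, continuous (l i).
Hypothesis basisE : forall w, w = \sum_i l i w *: b i.

Lemma derive_comp_basis (f : W -> R) (g : V -> W) (x v : V) :
  differentiable g x -> differentiable f (g x) ->
  'D_v (f \o g) x = \sum_i l i ('D_v g x) * 'D_(b i) f (g x).
Proof.
move=> dg df; have dfg := differentiable_comp dg df.
rewrite (deriveE _ dfg) (diff_comp dg df) /= -(deriveE v dg).
rewrite {1}[X in 'd _ _ X]basisE linear_sum; apply: eq_bigr => i _.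
by rewrite linearZ /= (deriveE _ df).
Qed.

(** In a finite basis the derivative of [f \o g] is a sum of products of functions of the same kind,
    one order lower, so the induction closes without any regularity of the full differential of [f].
    The basis is abstract to cover both row vectors and pairs of row vectors. *)
Lemma Ck_on_comp_basis k (U : set V) (U' : set W) (f : W -> R) (g : V -> W) :
  open U -> (forall x, U x -> U' (g x)) ->
  Ck_on k U' f -> Ck_on k U g -> Ck_on k U (f \o g).
Proof.
move=> oU UU'; elim: k f => [|k IH] f.
  move=> cf cg x Ux; apply: continuous_comp; first exact: cg.
  by apply: cf; exact: UU'.
move=> cf cg; have [df Df] := cf; have [dg Dg] := cg; split=> [x Ux|v].
  by apply: differentiable_comp; [exact: dg|apply: df; exact: UU'].
apply: (@Ck_on_ext _ _ _ _ _
   (fun x => \sum_i l i ('D_v g x) * ('D_(b i) f \o g) x)) => //.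
  by move=> x Ux; rewrite derive_comp_basis //; [exact: dg|exact/df/UU'].
apply: Ck_on_sum => // i _; apply: Ck_onM => //.
  by apply: Ck_on_linear_comp => //; exact: Dg.
by apply: IH; [exact: Df|exact: Ck_onW cg].
Qed.

End Basis.

Lemma rV_basisE n (w : 'rV[R]_n) :
  w = \sum_i mxcoord ord0 i w *: delta_mx ord0 i.
Proof. exact: row_sum_delta. Qed.

Lemma Ck_on_mx V m n k (U : set V) (F : V -> 'M[R]_(m, n)) : open U ->
  (forall i j, Ck_on k U (fun x => F x i j)) -> Ck_on k U F.
Proof.
move=> oU H.
apply: (@Ck_on_ext _ _ _ _ _
  (fun x => \sum_i \sum_j F x i j *: delta_mx i j)) => //.
  by move=> x _; rewrite -matrix_sum_delta.
apply: Ck_on_sum => // i _; apply: Ck_on_sum => // j _.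
pose s : R -> 'M[R]_(m, n) := *:%R^~ (delta_mx i j).
have sl : linear s by move=> a u v; rewrite /s scalerDl scalerA.
pose sM := GRing.isLinear.Build _ _ _ _ _ sl.
pose sL : {linear R -> 'M[R]_(m, n)} := HB.pack s sM.
apply: (@Ck_on_linear_comp _ _ _ _ _ _ sL) => // x.
exact: scalel_continuous.
Qed.

Lemma Ck_on_coord V m n k (U : set V) (F : V -> 'M[R]_(m, n)) i j : open U ->
  Ck_on k U F -> Ck_on k U (fun x => F x i j).
Proof.
move=> oU; apply: (@Ck_on_linear_comp _ _ _ _ _ _ (mxcoord i j)) => //.
exact: mxcoord_continuous.
Qed.

Lemma smooth_on_mx V m n (U : set V) (F : V -> 'M[R]_(m, n)) : open U ->
  (forall i j, smooth_on U (fun x => F x i j)) -> smooth_on U F.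
Proof. by move=> oU H k; apply: Ck_on_mx => // i j; exact: H. Qed.

Lemma smooth_on_coord V m n (U : set V) (F : V -> 'M[R]_(m, n)) i j : open U ->
  smooth_on U F -> smooth_on U (fun x => F x i j).
Proof. by move=> oU H k; exact: Ck_on_coord. Qed.

Lemma smooth_on_comp V m p q (U : set V) (U' : set 'rV[R]_m)
    (f : 'rV[R]_m -> 'M[R]_(p, q)) (g : V -> 'rV[R]_m) :
  open U -> open U' -> (forall x, U x -> U' (g x)) ->
  smooth_on U' f -> smooth_on U g -> smooth_on U (fun x => f (g x)).
Proof.
move=> oU oU' UU' sf sg k; apply: Ck_on_mx => // i j.
apply: (Ck_on_comp_basis (@mxcoord_continuous R 1 m ord0) (@rV_basisE m)
  (f := fun w => f w i j)) => //.
  exact: UU'.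
by apply: Ck_on_coord; [|exact: sf].
Qed.

(** The disjoint sum as index set gives the product space a finite basis, so that the chain rule
    above also serves maps of two variables, such as a group operation. *)
Definition paircoord m n (s : 'I_m + 'I_n) : 'rV[R]_m * 'rV[R]_n -> R :=
  match s with inl i => fun w => w.1 0 i | inr j => fun w => w.2 0 j end.

Lemma paircoord_linear m n (s : 'I_m + 'I_n) : linear (@paircoord m n s).
Proof. by move=> a A B; case: s => i /=; rewrite !mxE. Qed.

HB.instance Definition _ m n (s : 'I_m + 'I_n) :=
  GRing.isLinear.Build R ('rV[R]_m * 'rV[R]_n)%type R _ (@paircoord m n s)
    (@paircoord_linear m n s).

Lemma paircoord_continuous m n (s : 'I_m + 'I_n) :
  continuous (@paircoord m n s).
Proof.
by case: s => i x; apply: (@continuous_comp _ _ _ _ (mxcoord 0 i));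
  [exact: cvg_fst|exact: mxcoord_continuous
  |exact: cvg_snd|exact: mxcoord_continuous].
Qed.

Definition pairbasis m n (s : 'I_m + 'I_n) : 'rV[R]_m * 'rV[R]_n :=
  match s with inl i => (delta_mx 0 i, 0) | inr j => (0, delta_mx 0 j) end.

Lemma pair_basisE m n (w : 'rV[R]_m * 'rV[R]_n) :
  w = \sum_s paircoord s w *: pairbasis s.
Proof.
rewrite big_sumType /=; case: w => a b /=.
have fst_sum (I : finType) (F : I -> 'rV[R]_m * 'rV[R]_n) :
  (\sum_i F i).1 = \sum_i (F i).1 by exact: (@raddf_sum _ _ fst).
have snd_sum (I : finType) (F : I -> 'rV[R]_m * 'rV[R]_n) :
  (\sum_i F i).2 = \sum_i (F i).2 by exact: (@raddf_sum _ _ snd).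
apply: injective_projections; rewrite /= ?fst_sum ?snd_sum /=.
  rewrite [X in _ + X]big1 ?addr0 => [|i _]; last by rewrite scaler0.
  exact: row_sum_delta.
rewrite [X in X + _]big1 ?add0r => [|i _]; last by rewrite scaler0.
exact: row_sum_delta.
Qed.

Lemma smooth_on_comp2 V m n p q (U : set V) (U' : set ('rV[R]_m * 'rV[R]_n))
    (f : 'rV[R]_m * 'rV[R]_n -> 'M[R]_(p, q))
    (g : V -> 'rV[R]_m * 'rV[R]_n) :
  open U -> open U' -> (forall x, U x -> U' (g x)) ->
  smooth_on U' f -> smooth_on U g -> smooth_on U (fun x => f (g x)).
Proof.
move=> oU oU' UU' sf sg k; apply: Ck_on_mx => // i j.
apply: (Ck_on_comp_basis (@paircoord_continuous m n) (@pair_basisE m n)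
  (f := fun w => f w i j)) => //.
  exact: UU'.
by apply: Ck_on_coord; [|exact: sf].
Qed.

Lemma smooth_on_pair V m n (U : set V) (f : V -> 'rV[R]_m) (g : V -> 'rV[R]_n) :
  open U -> smooth_on U f -> smooth_on U g -> smooth_on U (fun x => (f x, g x)).
Proof.
move=> oU sf sg k.
have lL : linear (fun a : 'rV[R]_m => (a, 0 : 'rV[R]_n)).
  by move=> a u v; congr pair; rewrite /= scaler0 addr0.
have lR : linear (fun a : 'rV[R]_n => (0 : 'rV[R]_m, a)).
  by move=> a u v; congr pair; rewrite /= scaler0 addr0.
pose LM := GRing.isLinear.Build _ _ _ _ _ lL.
pose RM := GRing.isLinear.Build _ _ _ _ _ lR.
pose LL : {linear 'rV[R]_m -> ('rV[R]_m * 'rV[R]_n)%type} := HB.pack (fun a : 'rV[R]_m => (a, 0 : 'rV[R]_n)) LM.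
pose RR : {linear 'rV[R]_n -> ('rV[R]_m * 'rV[R]_n)%type} := HB.pack (fun a : 'rV[R]_n => (0 : 'rV[R]_m, a)) RM.
apply: (@Ck_on_ext _ _ _ _ _ (fun x => LL (f x) + RR (g x))) => //.
  by move=> x _; congr pair; rewrite /= ?addr0 ?add0r.
apply: Ck_onD => //.
  apply: (@Ck_on_linear_comp _ _ _ _ _ _ LL f) => //.
  by move=> x; apply: differentiable_continuous;
     apply: (@differentiable_pair _ _ _ _ id (fun=> 0)).
apply: (@Ck_on_linear_comp _ _ _ _ _ _ RR g) => //.
by move=> x; apply: differentiable_continuous;
   apply: (@differentiable_pair _ _ _ _ (fun=> 0) id).
Qed.

Lemma smooth_on_mulmx V m n p (U : set V) (F : V -> 'M[R]_(m, n))
    (H : V -> 'M[R]_(n, p)) : open U ->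
  smooth_on U F -> smooth_on U H -> smooth_on U (fun x => F x *m H x).
Proof.
move=> oU sF sH k; apply: Ck_on_mx => // i j.
apply: (@Ck_on_ext _ _ _ _ _ (fun x => \sum_l F x i l * H x l j)) => //.
  by move=> x _; rewrite mxE.
by apply: Ck_on_sum => // l _; apply: Ck_onM => //; apply: Ck_on_coord.
Qed.

Lemma smooth_on_trmx V m n (U : set V) (F : V -> 'M[R]_(m, n)) : open U ->
  smooth_on U F -> smooth_on U (fun x => (F x)^T).
Proof.
move=> oU sF; apply: smooth_on_mx => // i j.
apply: (@smooth_on_ext _ _ _ _ (fun x => F x j i)) => //.
  by move=> x _; rewrite mxE.
exact: smooth_on_coord.
Qed.

Lemma smooth_on_scale V m n (U : set V) (h : V -> R) (F : V -> 'M[R]_(m, n)) :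
  open U -> smooth_on U h -> smooth_on U F -> smooth_on U (fun x => h x *: F x).
Proof.
move=> oU sh sF k; apply: Ck_on_mx => // i j.
apply: (@Ck_on_ext _ _ _ _ _ (fun x => h x * F x i j)) => //.
  by move=> x _; rewrite mxE.
by apply: Ck_onM => //; apply: Ck_on_coord.
Qed.

Lemma smooth_on_cst V W (U : set V) (a : W) : smooth_on U (fun=> a).
Proof. by move=> k; exact: Ck_on_cst. Qed.

Lemma smooth_on_id V (U : set V) : smooth_on U id.
Proof. by move=> k; exact: Ck_on_id. Qed.

Lemma smooth_onD V W (U : set V) (f g : V -> W) : open U ->
  smooth_on U f -> smooth_on U g -> smooth_on U (fun x => f x + g x).
Proof. by move=> oU sf sg k; apply: Ck_onD; [|exact: sf|exact: sg]. Qed.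

Lemma smooth_on_det V n (U : set V) (F : V -> 'M[R]_n) : open U ->
  smooth_on U F -> smooth_on U (fun x => \det (F x)).
Proof.
move=> oU sF k; apply: Ck_on_sum => // s _; apply: Ck_onM => //.
  exact: Ck_on_cst.
by apply: Ck_on_prod => // i; apply: Ck_on_coord.
Qed.

Lemma smooth_onV V (U : set V) (f : V -> R) : open U ->
  (forall x, U x -> f x != 0) -> smooth_on U f ->
  smooth_on U (fun x => (f x)^-1).
Proof. by move=> oU f0 sf k; apply: Ck_onV; [|exact: f0|exact: sf]. Qed.

Lemma smooth_on_sqrt V (U : set V) (f : V -> R) : open U ->
  (forall x, U x -> 0 < f x) -> smooth_on U f ->
  smooth_on U (fun x => Num.sqrt (f x)).
Proof. by move=> oU f0 sf k; apply: Ck_on_sqrt; [|exact: f0|exact: sf]. Qed.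

Lemma smooth_on_cofactor V n (U : set V) (F : V -> 'M[R]_n) i j : open U ->
  smooth_on U F -> smooth_on U (fun x => cofactor (F x) i j).
Proof.
move=> oU sF k; apply: Ck_onM => //; first exact: Ck_on_cst.
apply: smooth_on_det => //; apply: smooth_on_mx => // a b.
apply: (@smooth_on_ext _ _ _ _ (fun x => F x (lift i a) (lift j b))) => //.
  by move=> x _; rewrite !mxE.
exact: smooth_on_coord.
Qed.

Lemma smooth_on_invmx V n (U : set V) (F : V -> 'M[R]_n) : open U ->
  (forall x, U x -> F x \in unitmx) ->
  smooth_on U F -> smooth_on U (fun x => invmx (F x)).
Proof.
move=> oU uF sF.
apply: (@smooth_on_ext _ _ _ _ (fun x => (\det (F x))^-1 *: \adj (F x))) => //.
  by move=> x /uF uFx; rewrite /invmx uFx.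
apply: smooth_on_scale => //.
  apply: smooth_onV => // [x /uF|]; first by rewrite unitmxE unitfE.
  exact: smooth_on_det.
apply: smooth_on_mx => // i j.
apply: (@smooth_on_ext _ _ _ _ (fun x => cofactor (F x) j i)) => //.
  by move=> x _; rewrite mxE.
exact: smooth_on_cofactor.
Qed.

End CkComp.

(** * Mean value inequalities and symmetry of second derivatives *)

Section MeanValue.
Variable R : realType.
Implicit Types V W : normedModType R.

Lemma is_derive_line V (f : V -> R) (x v : V) (t : R) :
  differentiable f (x + t *: v) ->
  is_derive t 1 (fun s : R => f (x + s *: v)) ('D_v f (x + t *: v)).
Proof.
move=> df; pose l : R -> V := fun s => x + s *: v.
have dl : is_diff t l ( *:%R^~ v).
  have ds : is_diff t (fun s : R => s *: v) ( *:%R^~ v).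
    exact: is_diff_scalel.
  apply: DiffDef; first by apply: differentiableD => //; exact: ex_diff.
  rewrite diffD // diff_cst diff_val; apply/funext => s.
  by rewrite -[LHS]/(0 + s *: v) add0r.
have dc : differentiable (f \o l) t by exact: differentiable_comp.
apply: DeriveDef; first exact/diff_derivable.
rewrite -[LHS]/('D_1 (f \o l) t) (deriveE _ dc) diff_comp //= (deriveE _ df).
by rewrite diff_val scale1r.
Qed.

Lemma mean_value V (f : V -> R) (x v : V) :
  (forall t : R, 0 <= t <= 1 -> differentiable f (x + t *: v)) ->
  exists2 t : R, 0 <= t <= 1 & f (x + v) - f x = 'D_v f (x + t *: v).
Proof.
move=> df; pose g (s : R) := f (x + s *: v).
have dg (s : R) : 0 <= s <= 1 -> is_derive s 1 g ('D_v f (x + s *: v)).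
  by move=> /df; exact: is_derive_line.
have [||t t01] := @MVT_segment R g (fun s => 'D_v f (x + s *: v)) 0 1 ler01.
- move=> s s01; apply: dg; move: s01; rewrite in_itv /=.
  by move=> /andP[/ltW -> /ltW ->].
- apply: derivable_within_continuous => s s01.
  by have [] := dg s; rewrite in_itv /= in s01.
rewrite /g scale1r scale0r addr0 subr0 mulr1 => ->.
by exists t => //; rewrite in_itv /= in t01.
Qed.

Lemma deriveZv V W (f : V -> W) (x v : V) (s : R) : differentiable f x ->
  'D_(s *: v) f x = s *: 'D_v f x.
Proof. by move=> df; rewrite !deriveE // linearZ. Qed.

Lemma ball_line V (x y v : V) (r t : R) :
  0 <= t <= 1 -> ball x r y -> ball x r (y + v) -> ball x r (y + t *: v).
Proof.
move=> /andP[t0 t1]; rewrite -!ball_normE /= => xy xyv.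
have -> : x - (y + t *: v) = (1 - t) *: (x - y) + t *: (x - (y + v)).
  rewrite !opprD !addrA; move: (x - y) => w.
  by rewrite scalerBl scale1r scalerBr addrA subrK.
apply: le_lt_trans (ler_normD _ _) _; rewrite !normrZ.
rewrite (ger0_norm t0) ger0_norm ?subr_ge0 //.
(* For [t = 0] the second summand vanishes and cannot supply the strict inequality. *)
have [t_eq0|tn0] := eqVneq t 0.
  by rewrite t_eq0 subr0 mul1r mul0r addr0.
apply: (@lt_le_trans _ _ ((1 - t) * r + t * r)); last first.
  by rewrite -mulrDl subrK mul1r.
apply: ler_ltD; first by apply: ler_wpM2l; [rewrite subr_ge0|exact: ltW].
by rewrite ltr_pM2l // lt_neqAle eq_sym tn0.
Qed.

(** The mean value theorem is used twice: for [phi y = f (y + s *: b) - f y] in the direction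
    [s *: a], then for ['D_a f] in the direction [s *: b]. *)
Lemma double_difference V (f : V -> R) (x a b : V) (r s : R) :
  0 < s -> s * (`|a| + `|b|) < r ->
  (forall y, ball x r y -> differentiable f y) ->
  (forall y, ball x r y -> differentiable ('D_a f) y) ->
  exists2 y, ball x r y &
    f (x + s *: a + s *: b) - f (x + s *: a) - f (x + s *: b) + f x =
    s ^+ 2 * 'D_b ('D_a f) y.
Proof.
move=> s0 sr df dDf.
have inball (p q : R) : 0 <= p <= 1 -> 0 <= q <= 1 ->
    ball x r (x + p *: (s *: a) + q *: (s *: b)).
  move=> /andP[p0 p1] /andP[q0 q1]; rewrite -ball_normE /=.
  rewrite -addrA opprD addrA subrr add0r normrN.
  apply: le_lt_trans sr; apply: le_trans (ler_normD _ _) _.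
  rewrite !normrZ (ger0_norm p0) (ger0_norm q0) (gtr0_norm s0) mulrDr lerD //.
    by rewrite ler_piMl // mulr_ge0 // ltW.
  by rewrite ler_piMl // mulr_ge0 // ltW.
have i0 : 0 <= (0 : R) <= 1 by rewrite lexx ler01.
have i1 : 0 <= (1 : R) <= 1 by rewrite lexx ler01.
pose sh (y : V) := y + s *: b.
have dsh y : differentiable sh y by apply: differentiableD.
have dsh_val y : 'd sh y = id :> (V -> V).
  rewrite /sh diffD // diff_val diff_cst; apply/funext => z.
  by rewrite -[LHS]/(z + 0) addr0.
pose phi (y : V) := f (sh y) - f y.
have dfsh y : differentiable f (sh y) -> differentiable (f \o sh) y.
  by move=> ?; exact: differentiable_comp.
have inA (t : R) : 0 <= t <= 1 -> ball x r (x + t *: (s *: a)).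
  by move=> t01; have := inball t 0 t01 i0; rewrite scale0r addr0.
have inAB (t : R) : 0 <= t <= 1 -> ball x r (sh (x + t *: (s *: a))).
  by move=> t01; have := inball t 1 t01 i1; rewrite scale1r.
have dphi (t : R) : 0 <= t <= 1 -> differentiable phi (x + t *: (s *: a)).
  move=> t01; apply: differentiableB; last exact/df/inA.
  by apply: dfsh; exact/df/inAB.
have [t t01 phiE] := mean_value dphi.
have [q q01 psiE] : exists2 q : R, 0 <= q <= 1 &
    'D_a f (x + t *: (s *: a) + s *: b) - 'D_a f (x + t *: (s *: a)) =
    'D_(s *: b) ('D_a f) (x + t *: (s *: a) + q *: (s *: b)).
  by apply: (@mean_value _ ('D_a f)) => q q01; exact: dDf (inball t q t01 q01).
exists (x + t *: (s *: a) + q *: (s *: b)); first exact: inball.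
rewrite expr2 -mulrA.
have -> : s * 'D_b ('D_a f) (x + t *: (s *: a) + q *: (s *: b)) =
    'D_(s *: b) ('D_a f) (x + t *: (s *: a) + q *: (s *: b)).
  by rewrite deriveZv //; exact/dDf/inball.
rewrite -psiE mulrBr.
have -> : f (x + s *: a + s *: b) - f (x + s *: a) - f (x + s *: b) + f x =
    phi (x + s *: a) - phi x by rewrite /phi /sh; ring.
rewrite phiE.
have dB : 'D_(s *: a) phi (x + t *: (s *: a)) =
    'D_(s *: a) (f \o sh) (x + t *: (s *: a)) -
    'D_(s *: a) f (x + t *: (s *: a)).
  apply: deriveB; apply: diff_derivable; last exact/df/inA.
  by apply: dfsh; exact/df/inAB.
rewrite dB !deriveZv; last 2 first.
- exact/df/inA.
- by apply: dfsh; exact/df/inAB.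
suff -> : 'D_a (f \o sh) (x + t *: (s *: a)) =
  'D_a f (x + t *: (s *: a) + s *: b) by [].
rewrite deriveE; last by apply: dfsh; exact/df/inAB.
rewrite diff_comp //; last exact/df/inAB.
by rewrite /= dsh_val deriveE //; exact/df/inAB.
Qed.

(** The double difference is symmetric in [a] and [b]. Expanding it in both orders gives two points
    near [x] at which the two mixed derivatives agree; each is within [e / 2] of its value at [x] by
    continuity. *)
Lemma schwarz V (U : set V) (f : V -> R) (x a b : V) :
  open U -> U x -> Ck_on 2 U f -> 'D_a ('D_b f) x = 'D_b ('D_a f) x.
Proof.
move=> oU Ux [df Df].
have cont c d : {for x, continuous ('D_d ('D_c f))}.
  by have [_ /(_ d)/(_ x Ux)] := Df c.
apply/eqP; rewrite -subr_eq0 -normr_le0; apply/ler_addgt0Pl => e e0.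
rewrite addr0.
have e2 : 0 < e / 2 by rewrite divr_gt0.
have nU : nbhs x U by apply: open_nbhs_nbhs.
have /cvgrPdist_lt/(_ _ e2) ca := cont a b.
have /cvgrPdist_lt/(_ _ e2) cb := cont b a.
move: ca cb => /nbhs_ballP[r1 /= r10 H1] /nbhs_ballP[r2 /= r20 H2].
move: nU => /nbhs_ballP[r3 /= r30 H3].
pose r := Num.min r1 (Num.min r2 r3).
have r0 : 0 < r by rewrite !lt_min r10 r20.
have s1 : ball x r `<=` ball x r1 by apply: le_ball; rewrite ge_min lexx.
have s2 : ball x r `<=` ball x r2.
  by apply: le_ball; rewrite !ge_min lexx orbT.
have s3 : ball x r `<=` ball x r3.
  by apply: le_ball; rewrite !ge_min lexx !orbT.
have [s s0 sr] : exists2 s : R, 0 < s & s * (`|a| + `|b|) < r.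
  (* The summand 1 keeps the denominator positive when [a] and [b] are both 0. *)
  have ab0 : 0 < `|a| + `|b| + 1 by rewrite ltr_wpDl // addr_ge0.
  exists (r / (`|a| + `|b| + 1)); first by rewrite divr_gt0.
  by rewrite mulrAC ltr_pdivrMr // ltr_pM2l // ltrDl.
have dfb y : ball x r y -> differentiable f y by move=> /s3/H3/df.
have dDfb c y : ball x r y -> differentiable ('D_c f) y.
  by move=> /s3/H3 Uy; have [+ _] := Df c; exact.
have sr' : s * (`|b| + `|a|) < r by rewrite [_ + _]addrC.
have [y yb E1] := double_difference s0 sr dfb (dDfb a).
have [z zb E2] := double_difference s0 sr' dfb (dDfb b).
have E : s ^+ 2 * 'D_b ('D_a f) y = s ^+ 2 * 'D_a ('D_b f) z.
  rewrite -E1 -E2 [x + s *: b + _]addrAC.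
  exact: (congr1 (fun t => t + f x) (addrAC _ _ _)).
have {}E : 'D_b ('D_a f) y = 'D_a ('D_b f) z.
  by apply: mulfI E; rewrite expf_neq0 // gt_eqF.
have Hz := H2 _ (s2 _ zb); have Hy := H1 _ (s1 _ yb).
apply: ltW; rewrite (splitr e).
rewrite -(subrK ('D_a ('D_b f) z) ('D_a ('D_b f) x)) -addrA.
apply: le_lt_trans (ler_normD _ _) _; apply: ltrD; first exact: Hz.
by rewrite -E distrC; exact: Hy.
Qed.

(** The factor [m] arises from the maximum norm: each of the [m] terms of the derivative along
    [y - z] is at most [C] times that norm. *)
Lemma lipschitz_ball m (f : 'rV[R]_m -> R) (x : 'rV[R]_m) (r C : R) :
  0 <= C ->
  (forall y, ball x r y -> differentiable f y) ->
  (forall y i, ball x r y -> `|'D_(delta_mx 0 i) f y| <= C) ->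
  forall y z, ball x r y -> ball x r z -> `|f y - f z| <= m%:R * C * `|y - z|.
Proof.
move=> C0 df Df y z yb zb.
have ln (t : R) : 0 <= t <= 1 -> ball x r (z + t *: (y - z)).
  by move=> t01; apply: ball_line => //; rewrite addrC subrK.
have [t t01] := mean_value (fun t t01 => df _ (ln t t01)).
rewrite [z + _]addrC subrK => ->.
set w := z + _; have wb : ball x r w by exact: ln.
rewrite deriveE; last exact: df.
rewrite [X in 'd _ _ X]row_sum_delta linear_sum.
apply: le_trans (ler_norm_sum _ _ _) _.
rewrite -mulrA -[m in m%:R]card_ord -sumr_const mulr_suml.
apply: ler_sum => i _; rewrite mul1r linearZ /= normrM mulrC.
apply: ler_pM => //.
  by rewrite -deriveE; [exact: Df|exact: df].
rewrite [leRHS]/Num.Def.normr /= mx_normrE.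
exact: (@le_bigmax _ _ _ 0 (fun ij => `|(y - z) ij.1 ij.2|) (0, i)).
Qed.

End MeanValue.
(** * Sard's theorem for maps with singular differential *)

Lemma natr_near_inj (R : realType) (a b : nat) :
  `|a%:R - b%:R| < 1 :> R -> a = b.
Proof.
rewrite ltr_norml => /andP[]; rewrite ltrBrDr ltrBlDr => l1 l2.
apply/eqP; rewrite eqn_leq; apply/andP; split.
  by rewrite -ltnS -(ltr_nat R) -natr1 addrC.
by rewrite -ltnS -(ltr_nat R) -natr1 -ltrBlDr addrC.
Qed.

Lemma modn_near_inj (B a b : nat) :
  (a <= b + B)%N -> (b <= a + B)%N -> a = b %[mod B.+1] -> a = b.
Proof.
wlog le_ab : a b / (a <= b)%N.
  move=> H; case: (leqP a b) => [/H//|/ltnW ba] le1 le2 E.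
  by apply: esym; apply: H.
move=> _ le_b /esym/eqP; rewrite (eqn_mod_dvd _ le_ab) => /dvdnP[[|q]].
  by rewrite mul0n; lia.
by rewrite mulSn; lia.
Qed.

(** Coordinates of two members of [P] differ by at most [B], so they are known from their residues
    modulo [B.+1]; the residues of the [m] coordinates other than [j] therefore encode the members
    injectively. *)
Lemma card_grid_fibre (m K B : nat) (P : {set {ffun 'I_m.+1 -> 'I_K}})
    (j : 'I_m.+1) :
  (forall i i', i \in P -> i' \in P -> forall l, (i l <= i' l + B)%N) ->
  (forall i i', i \in P -> i' \in P ->
     (forall l, l != j -> i l = i' l) -> i j = i' j) ->
  (#|P| <= B.+1 ^ m)%N.
Proof.
move=> near_P inj_P.
pose code (i : {ffun 'I_m.+1 -> 'I_K}) : {ffun 'I_m -> 'I_B.+1} :=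
  [ffun l => inord (i (lift j l) %% B.+1)].
have code_inj : {in P &, injective code}.
  move=> i i' iP i'P /ffunP cE.
  have E l : l != j -> i l = i' l.
    rewrite eq_sym => /unlift_some[l' -> _].
    have /(congr1 val) := cE l'.
    rewrite !ffunE /= !inordK ?ltn_mod // => mE.
    have := near_P _ _ iP i'P (lift j l'); have := near_P _ _ i'P iP (lift j l').
    by move=> le1 le2; apply: val_inj; exact: (@modn_near_inj B).
  apply/ffunP => l; have [->|lj] := eqVneq l j; last exact: E.
  exact: inj_P.
rewrite -(card_in_imset code_inj); apply: leq_trans (max_card _) _.
by rewrite card_ffun !card_ord.
Qed.

Lemma nat_above (R : realType) (x : R) : exists n : nat, x <= n%:R.
Proof.
exists (Num.bound `|x|); apply: le_trans (ler_norm x) _; apply: ltW.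
exact: archi_boundP.
Qed.

Section SardCounting.
Variables (R : realType) (m p : nat).
Variables (h : 'I_p -> 'rV[R]_m.+1 -> 'rV[R]_m.+1).
Variables (x : 'I_p -> 'rV[R]_m.+1) (r : 'I_p -> R) (rho : R).
Hypothesis rho_gt0 : 0 < rho.
Hypothesis lipschitz : exists L, exists2 d, 0 < d &
  forall q y z, `|y - x q| <= r q -> `|z - x q| <= r q -> `|y - z| <= d ->
    `|h q y - h q z| <= L * `|y - z|.
(** A uniform form of singularity of the differential: [w] is a covector that almost annihilates the
    increments of [h q] near [y]. Its entry of absolute value 1 singles out a coordinate of the
    image that the others determine up to a small error. *)
Hypothesis flat : forall eta, 0 < eta -> exists2 d, 0 < d &
  forall q y, `|y - x q| <= r q -> exists w : 'rV[R]_m.+1,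
    (exists j, `|w 0 j| = 1) /\
    forall z z', `|z - x q| <= r q -> `|z' - x q| <= r q ->
      `|z - y| <= d -> `|z' - y| <= d ->
      `|\sum_l w 0 l * (h q z - h q z') 0 l| <= eta * `|z - z'|.

Lemma ler_coord (y : 'rV[R]_m.+1) l : `|y 0 l| <= `|y|.
Proof.
rewrite [leRHS]/Num.Def.normr /= mx_normrE.
exact: (@le_bigmax _ _ _ 0 (fun ij => `|y ij.1 ij.2|) (0, l)).
Qed.

Lemma rV_norm_le (y : 'rV[R]_m.+1) (a : R) : (forall l, `|y 0 l| <= a) -> `|y| <= a.
Proof.
move=> H; rewrite [leLHS]/Num.Def.normr /= mx_normrE.
apply/bigmax_leP; split=> [|[i l] _ /=]; last by rewrite ord1.
exact: le_trans (normr_ge0 _) (H ord0).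
Qed.

(* A grid of [(k e)^(m+1)] points of the cube is pulled back to the [p] boxes,
   each cut into [(k+1)^(m+1)] cells of size about [1/k].  The image of a cell is
   a thin slab, whose points are determined by [m] of their coordinates, each of
   which takes at most [C e + 1] values.  The exponent of [e] in the number of
   grid points is thus one too large, if [e] is large and then [k] is. *)
Lemma sard_counting : exists z : 'rV[R]_m.+1,
  (forall l, 0 <= z 0 l <= rho) /\
  forall q y, `|y - x q| <= r q -> h q y <> z.
Proof.
apply: contrapT => noz.
have cover (z : 'rV[R]_m.+1) : (forall l, 0 <= z 0 l <= rho) ->
    {qy : ('I_p * 'rV[R]_m.+1)%type | `|qy.2 - x qy.1| <= r qy.1 /\ h qy.1 qy.2 = z}.
  move=> zb; apply: cid; apply: contrapT => H; apply: noz; exists z; split=> //.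
  by move=> q y yq E; apply: H; exists (q, y).
have [L [d1 d10 Lip]] := lipschitz.
(* A single length that dominates the side [2 * r q] of every box; the summand 1 keeps it
   positive. *)
pose D : R := 1 + \sum_q 2 * `|r q|.
have sum0 : 0 <= \sum_q 2 * `|r q| by apply: sumr_ge0 => q _; rewrite mulr_ge0.
have D0 : 0 < D by rewrite ltr_wpDr.
have rD q : 2 * r q <= D.
  rewrite /D (bigD1 q) //= addrCA.
  apply: le_trans (_ : 2 * `|r q| <= _); first by rewrite ler_pM2l // ler_norm.
  by rewrite lerDl addr_ge0 // sumr_ge0 // => ? _; rewrite mulr_ge0.
(* A cell of size [D / k] has an image of size at most [|L| * D / k], which is at most [C * e] in
   units of the grid spacing [rho / (k * e)]. *)
have [C CE] := nat_above (`|L| * D / rho).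
(* One more than the constant that survives the count at the end, so that the final inequality is
   absurd. *)
pose e := (p * 2 ^ m.+1 * C.+1 ^ m).+1.
have e0 : 0 < e%:R :> R by rewrite ltr0n.
(* With this value the flatness error over a cell, [eta * (D / k)], is half of the grid spacing. *)
have eta0 : 0 < rho / (2 * e%:R * D) by rewrite divr_gt0 // !mulr_gt0.
have [d2 d20 Flat] := flat eta0.
have [k [k0 kd1 kd2]] : exists k : nat,
    [/\ (0 < k)%N, D / k%:R <= d1 & D / k%:R <= d2].
  have [k1 k1E] := nat_above (D / d1); have [k2 k2E] := nat_above (D / d2).
  have E (a : nat) (d : R) : 0 < d -> D / d <= a%:R ->
      forall b : nat, (a <= b)%N -> (0 < b)%N -> D / b%:R <= d.
    move=> dgt0 H b ab b0; rewrite ler_pdivrMr ?ltr0n // mulrC.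
    by rewrite -ler_pdivrMr //; apply: le_trans H _; rewrite ler_nat.
  exists (maxn 1 (maxn k1 k2)); split.
  - by rewrite leq_max.
  - by apply: E k1E _ _ _; rewrite // !leq_max leqnn ?orbT.
  - by apply: E k2E _ _ _; rewrite // !leq_max leqnn ?orbT.
have kR0 : 0 < k%:R :> R by rewrite ltr0n.
pose K := (k * e)%N.
have K0 : (0 < K)%N by rewrite muln_gt0 k0.
have KR0 : 0 < K%:R :> R by rewrite ltr0n.
pose zg (i : {ffun 'I_m.+1 -> 'I_K}) : 'rV[R]_m.+1 :=
  \row_l (rho / K%:R * (i l)%:R).
have zgb i l : 0 <= zg i 0 l <= rho.
  rewrite mxE; apply/andP; split.
    by rewrite mulr_ge0 // divr_ge0 // ltW.
  rewrite mulrAC ler_pdivrMr // ler_pM2l // ler_nat.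
  exact: ltnW.
pose Q i := (sval (cover (zg i) (zgb i))).1.
pose Y i := (sval (cover (zg i) (zgb i))).2.
have Yb i : `|Y i - x (Q i)| <= r (Q i).
  by rewrite /Y /Q; case: (cover _ _) => /= ? [].
have hY i : h (Q i) (Y i) = zg i.
  by rewrite /Y /Q; case: (cover _ _) => /= ? [].
pose u i l : R := (Y i - x (Q i)) 0 l + r (Q i).
have u_bound i l : 0 <= u i l <= D.
  have := le_trans (ler_coord (Y i - x (Q i)) l) (Yb i).
  rewrite ler_norml /u => /andP[le1 le2]; have := rD (Q i).
  by move: ((Y i - x (Q i)) 0 l) le1 le2 => a; lra.
(* The class [k] is reached only at the far end [u = D] of the range, whence [k.+1] classes per
   coordinate. *)
pose cl i : {ffun 'I_m.+1 -> 'I_k.+1} :=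
  [ffun l => inord (Num.trunc (u i l * k%:R / D))].
have u_ge0 i l : 0 <= u i l * k%:R / D.
  by have /andP[? _] := u_bound i l; rewrite divr_ge0 ?mulr_ge0 // ltW.
have cl_le i l : (Num.trunc (u i l * k%:R / D) < k.+1)%N.
  rewrite truncn_lt_nat // ltr_pdivrMr //.
  have /andP[_ uD] := u_bound i l.
  apply: le_lt_trans (_ : D * k%:R < _); first by rewrite ler_pM2r.
  by rewrite mulrC ltr_pM2r // ltr_nat.
have cell_close i i' : Q i = Q i' -> cl i = cl i' -> `|Y i - Y i'| <= D / k%:R.
  move=> QE /ffunP clE; apply: rV_norm_le => l.
  have /(congr1 val) := clE l; rewrite !ffunE /= !inordK // => tE.
  have /andP[a1 a2] := truncn_itv (u_ge0 i l).
  have /andP[b1 b2] := truncn_itv (u_ge0 i' l).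
  rewrite tE in a1 a2.
  have -> : (Y i - Y i') 0 l = u i l - u i' l by rewrite /u !mxE QE; ring.
  rewrite ler_pdivlMr // -{1}(gtr0_norm kR0) -normrM.
  rewrite -[leRHS]mul1r -ler_pdivrMr // -{1}(gtr0_norm D0) -normfV -normrM.
  rewrite !mulrBl ler_norml; rewrite -natr1 in a2 b2.
  by apply/andP; split; lra.
pose B := (C * e)%N.
have fibre c : (#|finset (fun i => (Q i, cl i) == c)| <= B.+1 ^ m)%N.
  case: c => q c; set P := finset _.
  have PP i : i \in P -> Q i = q /\ cl i = c by rewrite inE => /eqP[].
  have [->|[i0 i0P]] := finset.set_0Vmem P; first by rewrite cards0.
  have [Qi0 ci0] := PP _ i0P.
  have close i i' : i \in P -> i' \in P -> `|Y i - Y i'| <= D / k%:R.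
    move=> /PP[q1 c1] /PP[q2 c2].
    by apply: cell_close; rewrite ?q1 ?q2 ?c1 ?c2.
  have Yq i : i \in P -> `|Y i - x q| <= r q.
    by move=> /PP[<- _].
  have hq i : i \in P -> h q (Y i) = zg i by move=> /PP[<- _].
  (* One covector, taken at the point of [i0], serves the whole cell. *)
  have [w [[j wj] Hw]] := Flat q _ (Yq _ i0P).
  apply: (@card_grid_fibre _ _ _ _ j) => i i' iP i'P.
    move=> l; have dY := close _ _ iP i'P.
    have := Lip q _ _ (Yq _ iP) (Yq _ i'P) (le_trans dY kd1).
    rewrite !hq // => H.
    have {}H : rho / K%:R * `|(i l)%:R - (i' l)%:R| <= `|L| * (D / k%:R).
      apply: le_trans (_ : `|zg i - zg i'| <= _).
        apply: le_trans (ler_coord _ l); rewrite !mxE -mulrBr normrM.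
        by rewrite ger0_norm // divr_ge0 // ltW.
      apply: le_trans H _; apply: le_trans (_ : `|L| * `|Y i - Y i'| <= _).
        by rewrite ler_wpM2r // ler_norm.
      by rewrite ler_wpM2l.
    have {}H : `|(i l)%:R - (i' l)%:R| <= (C * e)%:R :> R.
      apply: le_trans (_ : `|L| * D / rho * e%:R <= _); last first.
        by rewrite natrM ler_pM2r.
      rewrite -(ler_pM2l (divr_gt0 rho_gt0 KR0)); apply: le_trans H _.
      rewrite /K natrM le_eqVlt; apply/orP; left; apply/eqP.
      by field; rewrite !gt_eqF.
    rewrite -(ler_nat R) natrD.
    by move: H; rewrite ler_norml => /andP[_]; rewrite lerBlDl.
  (* When all coordinates but [j] agree, the sum in [Hw] reduces to its [j]-th term, and the two
     indices are integers at distance at most one half. *)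
  move=> E.
  have := Hw _ _ (Yq _ iP) (Yq _ i'P)
    (le_trans (close _ _ iP i0P) kd2) (le_trans (close _ _ i'P i0P) kd2).
  rewrite !hq // (bigD1 j) //= big1 ?addr0 => [|l lj]; last first.
    by rewrite !mxE E // subrr mulr0.
  rewrite !mxE -mulrBr !normrM wj mul1r => H.
  have {}H : `|(i j)%:R - (i' j)%:R| <= 2^-1 :> R.
    have rK : 0 < `|rho| * `|K%:R^-1| :> R.
      by rewrite mulr_gt0 // normr_gt0 ?invr_eq0 gt_eqF.
    rewrite -(ler_pM2l rK).
    apply: le_trans H _; apply: le_trans
      (_ : rho / (2 * e%:R * D) * (D / k%:R) <= _).
      by apply: ler_wpM2l; [exact: ltW|exact: close].
    rewrite (gtr0_norm rho_gt0) gtr0_norm ?invr_gt0 //.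
    rewrite /K natrM le_eqVlt; apply/orP; left; apply/eqP.
    by field; rewrite !gt_eqF.
  apply: val_inj; apply: (@natr_near_inj R); apply: le_lt_trans H _.
  by rewrite invf_lt1 ?ltr1n.
have : (#|{ffun 'I_m.+1 -> 'I_K}| <= p * k.+1 ^ m.+1 * B.+1 ^ m)%N.
  rewrite -sum1_card (partition_big (fun i => (Q i, cl i)) xpredT) //=.
  apply: leq_trans (_ : \sum_(c : 'I_p * {ffun 'I_m.+1 -> 'I_k.+1}) B.+1 ^ m <= _)%N.
    apply: leq_sum => c _; apply: leq_trans (fibre c).
    by rewrite sum1_card; apply: eq_leq; apply: eq_card => i; rewrite !inE.
  by rewrite sum_nat_const card_prod card_ffun !card_ord.
rewrite card_ffun !card_ord /K /B => H.
suff : (e <= p * 2 ^ m.+1 * C.+1 ^ m)%N by rewrite /e ltnn.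
(* The number [(k * e) ^ m.+1] of grid points is [e] times this factor. On the other side
   [k.+1 <= 2 * k] and [(C * e).+1 <= C.+1 * e] bring out the same factor and leave a constant free
   of [k] and [e]. *)
have ke0 : (0 < k ^ m.+1 * e ^ m)%N by rewrite muln_gt0 !expn_gt0 k0.
rewrite -(leq_pmul2r ke0).
apply: leq_trans (_ : p * k.+1 ^ m.+1 * (C * e).+1 ^ m <= _)%N.
  by rewrite mulnCA -expnS -expnMn.
apply: leq_trans (_ : p * (2 * k) ^ m.+1 * (C.+1 * e) ^ m <= _)%N.
  have lexp a b c : (a <= b)%N -> (a ^ c <= b ^ c)%N.
    by case: c => // c ab; rewrite leq_exp2r.
  apply: leq_mul; first by apply: leq_mul => //; apply: lexp; rewrite mul2n -addnn -addn1 leq_add2l.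
  by apply: lexp; rewrite mulSn -add1n leq_add2r.
by rewrite !expnMn; apply/eq_leq; ring.
Qed.

End SardCounting.

(** * From the count in boxes to maps on a compact space *)

Section MiniSard.
Variable R : realType.

Definition rowdot n (w v : 'rV[R]_n) : R := \sum_l w 0 l * v 0 l.

Lemma rowdot_linear n (w : 'rV[R]_n) : linear (rowdot w).
Proof.
move=> a u v; rewrite /rowdot scaler_sumr -big_split /=; apply: eq_bigr => l _.
by rewrite !mxE mulrDr -[_ *: _]/(_ * _) mulrCA.
Qed.

HB.instance Definition _ n (w : 'rV[R]_n) :=
  GRing.isLinear.Build R 'rV[R]_n R _ (rowdot w) (@rowdot_linear n w).

Lemma rowdotE n (w v : 'rV[R]_n) : rowdot w v = (v *m w^T) 0 0.
Proof. by rewrite mxE; apply: eq_bigr => l _; rewrite mxE mulrC. Qed.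

Lemma rowdot_continuous n (w : 'rV[R]_n) : continuous (rowdot w).
Proof.
move=> x; have : Ck_on 0 [set: 'rV[R]_n] (rowdot w); last by move=> /(_ x I).
apply: Ck_on_sum; [exact: openT|move=> l _; apply: Ck_onM].
- exact: openT.
- exact: Ck_on_cst.
- by apply: Ck_on_coord; [exact: openT|exact: Ck_on_id].
Qed.

Lemma compact_cball n (x : 'rV[R]_n) (r : R) :
  compact [set u : 'rV[R]_n | `|u - x| <= r].
Proof.
apply: bounded_closed_compact.
  exists (`|x| + r); split; first exact: num_real.
  move=> M rM u /= ur; apply: ltW; apply: le_lt_trans rM.
  rewrite -(subrK x u) addrC; apply: le_trans (ler_normD _ _) _.
  by rewrite lerD2l.
have -> : [set u : 'rV[R]_n | `|u - x| <= r] = closed_ball_ Num.Def.normr x r.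
  by apply/funext => u /=; rewrite distrC.
exact: closed_closed_ball_.
Qed.

(** The differential sends [v] to [v *m J], so [w] annihilates its image; dividing by the maximum
    norm creates the entry of absolute value 1. *)
Lemma normalised_kernel n (J : 'M[R]_n) : \det J = 0 ->
  exists w : 'rV[R]_n, (exists j, `|w 0 j| = 1) /\ J *m w^T = 0.
Proof.
move=> dJ; have /det0P[v v0 vJ] : \det J^T == 0 by rewrite det_tr dJ.
have [[i j] /= vE] := mx_norm_neq0 (contra_neq (@mx_norm_eq0 _ _ _ v) v0).
have {}vE : `|v| = `|v 0 j| by move: vE; rewrite (ord1 i).
exists (`|v|^-1 *: v); split.
  by exists j; rewrite mxE normrM normfV normr_id -vE mulVf // normr_eq0.
by apply: trmx_inj; rewrite trmx_mul trmxK -scalemxAl vJ scaler0 trmx0.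
Qed.

Section Local.
Variables (m : nat) (h : 'rV[R]_m.+1 -> 'rV[R]_m.+1).
Variables (U K : set 'rV[R]_m.+1).
Hypotheses (oU : open U) (cK : compact K) (KU : K `<=` U).
Hypothesis hU : Ck_on 1 U h.

Let U_ball y : U y -> exists2 e : R, 0 < e & ball y e `<=` U.
Proof.
by move=> Uy; have /nbhs_ballP[e e0 eU] := open_nbhs_nbhs (conj oU Uy); exists e.
Qed.

(** The strict bound at [y] persists on a ball by continuity of the derivatives, and
    [lipschitz_ball] applies there to the scalar function [rowdot w (h z)]. A standard basis vector
    as [w] yields Lipschitz bounds, a kernel covector yields flatness. *)
Let coordinate_bound (y : 'rV[R]_m.+1) (w : 'rV[R]_m.+1) (C : R) : U y ->
  (forall i, `|rowdot w ('D_(delta_mx 0 i) h y)| < C) ->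
  exists2 e : R, 0 < e & forall z z', ball y e z -> ball y e z' ->
    `|rowdot w (h z - h z')| <= m.+1%:R * C * `|z - z'|.
Proof.
move=> Uy Db; have [e1 e10 e1U] := U_ball Uy.
have [dh Dh] := hU.
have C0 : 0 <= C by apply: le_trans (ltW (Db ord0)).
have nbi i : \forall z \near y, `|rowdot w ('D_(delta_mx 0 i) h z)| < C.
  have ct : {for y, continuous (fun z => `|rowdot w ('D_(delta_mx 0 i) h z)|)}.
    apply: continuous_comp; last exact: norm_continuous.
    apply: continuous_comp; last exact: rowdot_continuous.
    exact: Dh.
  exact: (cvgr_lt _ ct).
have nb : \forall z \near y, forall i, `|rowdot w ('D_(delta_mx 0 i) h z)| < C.
  exact: filter_forall nbi.
have /nbhs_ballP[e2 /= e20 e2b] := nb.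
exists (Num.min e1 e2); first by rewrite lt_min e10.
have s1 : ball y (Num.min e1 e2) `<=` ball y e1.
  by apply: le_ball; rewrite ge_min lexx.
have s2 : ball y (Num.min e1 e2) `<=` ball y e2.
  by apply: le_ball; rewrite ge_min lexx orbT.
move=> z z' zb z'b; rewrite linearB.
apply: (@lipschitz_ball R m.+1 (fun z => rowdot w (h z)) y (Num.min e1 e2)) => //.
  move=> v /s1/e1U/dh dv; apply: differentiable_comp => //.
  by apply: linear_differentiable; exact: rowdot_continuous.
move=> v i vb; rewrite derive_linear_comp; first by apply: ltW; exact: e2b (s2 _ vb) i.
  exact: rowdot_continuous.
by apply: dh; apply: e1U; exact: s1.
Qed.

(** Compactness of [K] turns thresholds for [d] that depend on the point into a common one. *)
Let near_uniform (P : R -> 'rV[R]_m.+1 -> Prop) :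
  (forall y0, K y0 -> exists2 e : R, 0 < e &
     forall y d, ball y0 e y -> 0 < d -> d < e -> P d y) ->
  \forall d \near (0 : R)^'+, forall y, K y -> P d y.
Proof.
move=> H; have /compact_near_coveringP/(_ R (0^'+) P) := cK.
move=> /(_ _) HK; apply: HK => y0 /H[e e0 He].
exists (ball y0 e, [set d | 0 < d < e]) => /=.
  split; first exact: nbhsx_ballx.
  near=> d; apply/andP; split; near: d; first exact: nbhs_right_gt.
  exact: nbhs_right_lt.
by move=> [y d] /= [yb /andP[d0 de]]; exact: He.
Unshelve. all: by end_near. Qed.

Let ball_shrink (y0 y z : 'rV[R]_m.+1) (e d : R) :
  ball y0 (e / 2) y -> d < e / 2 -> `|z - y| <= d -> ball y0 e z.
Proof.
rewrite -!ball_normE /= => yb de zy; rewrite -(subrKA y) (splitr e).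
apply: le_lt_trans (ler_normD _ _) _; apply: ltrD => //.
by rewrite distrC; exact: le_lt_trans de.
Qed.

(** The number [d] is both the radius and the inverse of the Lipschitz constant; the assertion then
    concerns all small [d], the form required by [near_uniform]. *)
Lemma locally_lipschitz : \forall d \near (0 : R)^'+, forall y, K y ->
  forall z z', `|z - y| <= d -> `|z' - y| <= d -> `|h z - h z'| <= d^-1 * `|z - z'|.
Proof.
apply: near_uniform => y0 /KU Uy0.
pose C j : R := 1 + \sum_i `|rowdot (delta_mx 0 j) ('D_(delta_mx 0 i) h y0)|.
have Cb j i : `|rowdot (delta_mx 0 j) ('D_(delta_mx 0 i) h y0)| < C j.
  rewrite /C (bigD1 i) //= addrCA ltrDl ltr_wpDr //.
  by apply: sumr_ge0.
have H j := coordinate_bound Uy0 (Cb j).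
pose e j := s2val (cid2 (H j)).
have e0 j : 0 < e j by rewrite /e; case: (cid2 _).
have He j z z' : ball y0 (e j) z -> ball y0 (e j) z' ->
    `|(h z - h z') 0 j| <= m.+1%:R * C j * `|z - z'|.
  rewrite /e; case: (cid2 _) => /= ? _ He zb z'b.
  have := He _ _ zb z'b; congr (`|_| <= _).
  rewrite /rowdot (bigD1 j) //= mxE !eqxx mul1r big1 ?addr0 // => l lj.
  by rewrite mxE eqxx (negPf lj) mul0r.
have C0 j : 0 < m.+1%:R * C j.
  by rewrite mulr_gt0 // (le_lt_trans _ (Cb j ord0)).
pose E := \big[Num.min/1]_j (Num.min (e j / 2) (m.+1%:R * C j)^-1).
have E0 : 0 < E.
  by apply: lt_bigmin => // j _; rewrite lt_min invr_gt0 C0 andbT divr_gt0.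
have Ee j : E <= e j / 2.
  by apply: le_trans (bigmin_le _ j _) _ => //; rewrite ge_min lexx.
have EC j : E <= (m.+1%:R * C j)^-1.
  by apply: le_trans (bigmin_le _ j _) _ => //; rewrite ge_min lexx orbT.
exists E => // y d yb d0 dE z z' zy z'y; apply: rV_norm_le => j.
have sh v : `|v - y| <= d -> ball y0 (e j) v.
  by apply: ball_shrink; [exact: le_ball (Ee j) _ yb|exact: lt_le_trans dE (Ee j)].
apply: le_trans (He j _ _ (sh _ zy) (sh _ z'y)) _; apply: ler_wpM2r => //.
rewrite -[leLHS]invrK lef_pV2 ?posrE ?invr_gt0 //.
exact: ltW (lt_le_trans dE (EC j)).
Qed.

(** For [w] in the kernel at [y0] all derivatives of [rowdot w (h z)] vanish at [y0], hence lie
    below [eta / m.+1%:R], which absorbs the factor of [coordinate_bound]. The same [w] is kept for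
    all [y] near [y0]. *)
Lemma locally_flat (eta : R) : 0 < eta ->
  (forall y, K y -> \det ('J h y) = 0) ->
  \forall d \near (0 : R)^'+, forall y, K y -> exists w : 'rV[R]_m.+1,
    (exists j, `|w 0 j| = 1) /\
    forall z z', `|z - y| <= d -> `|z' - y| <= d ->
      `|\sum_l w 0 l * (h z - h z') 0 l| <= eta * `|z - z'|.
Proof.
move=> eta0 dJ; apply: near_uniform => y0 Ky0; have Uy0 := KU Ky0.
have [w [wj Jw]] := normalised_kernel (dJ _ Ky0).
have [dh Dh] := hU.
have m0 : 0 < m.+1%:R :> R by rewrite ltr0n.
have Db i : `|rowdot w ('D_(delta_mx 0 i) h y0)| < eta / m.+1%:R.
  rewrite deriveEjacobian; last exact: dh.
  rewrite rowdotE.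
  by rewrite -mulmxA Jw mulmx0 mxE normr0 divr_gt0.
have [e e0 He] := coordinate_bound Uy0 Db.
exists (e / 2); first by rewrite divr_gt0.
move=> y d yb d0 de; exists w; split=> // z z' zy z'y.
have := He _ _ (ball_shrink yb de zy) (ball_shrink yb de z'y).
by rewrite mulrCA mulfV ?mulr1 // gt_eqF.
Qed.

End Local.

Lemma mini_sard (M : topologicalType) (m : nat) (phi : M -> 'rV[R]_m.+1) :
  compact [set: M] ->
  (forall p : M, exists (x : 'rV[R]_m.+1) (r : R) (pi : 'rV[R]_m.+1 -> M)
     (U : set 'rV[R]_m.+1),
     let K := [set u | `|u - x| <= r] in
     [/\ nbhs p (pi @` K), open U, K `<=` U, Ck_on 1 U (phi \o pi) &
         forall u, K u -> \det ('J (phi \o pi) u) = 0]) ->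
  forall rho : R, 0 < rho -> exists z : 'rV[R]_m.+1,
    (forall l, 0 <= z 0 l <= rho) /\ forall p : M, phi p <> z.
Proof.
move=> cM loc rho rho0.
have [x locx] := choice loc; have [r locr] := choice locx.
have [pi locpi] := choice locr; have [U locU] := choice locpi.
have [s cover_s] : exists s : seq M, forall p, exists2 q, q \in s &
    (pi q @` [set u | `|u - x q| <= r q]) p.
  (* The filter of finite sequences ordered by inclusion: with it, the covering form of compactness
     yields a finite subcover. *)
  pose F : set_system (seq M) :=
    filter_from setT (fun s0 : seq M => [set s : seq M | forall q, q \in s0 -> q \in s]).
  have FF : Filter F.
    apply: filter_from_filter; first by exists [::].
    move=> s1 s2 _ _; exists (s1 ++ s2) => // s /= sub.
    by split=> q qs; apply: sub; rewrite mem_cat qs ?orbT.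
  have PF : ProperFilter F by apply: filter_from_proper => s _; exists s => /=.
  have /compact_near_coveringP/(_ _ F (fun (s : seq M) p => exists2 q, q \in s &
    (pi q @` [set u | `|u - x q| <= r q]) p) FF) := cM.
  have loc_cover (p : M) : [set: M] p -> \forall p' \near p & s \near F,
      exists2 q, q \in s & (pi q @` [set u | `|u - x q| <= r q]) p'.
    move=> _; exists (pi p @` [set u | `|u - x p| <= r p],
                      [set s : seq M | forall q, q \in [:: p] -> q \in s]).
      by split; [have [] := locU p|exists [:: p]].
    by move=> [p' s] /= [Kp' sub]; exists p => //; apply: sub; rewrite inE.
  by move=> /(_ loc_cover)/filter_ex[s sP]; exists s => p; exact: sP.
pose t := in_tuple s; pose c (q : 'I_(size s)) := tnth t q.
have Hd (P : R -> 'I_(size s) -> Prop) :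
    (forall q, \forall d \near (0 : R)^'+, P d q) ->
    exists2 d, 0 < d & forall q, P d q.
  move=> H; have : \forall d \near (0 : R)^'+, 0 < d /\ forall q, P d q.
    near=> d; split; near: d; first exact: nbhs_right_gt.
    exact: filter_forall.
  by move=> /filter_ex[d []]; exists d.
have [||z [zb zE]] := @sard_counting R m (size s)
    (fun q => phi \o pi (c q)) (fun q => x (c q)) (fun q => r (c q)) rho rho0.
- have [|d d0 Lip] := Hd (fun d q => forall y, `|y - x (c q)| <= r (c q) ->
    forall z z', `|z - y| <= d -> `|z' - y| <= d ->
    `|(phi \o pi (c q)) z - (phi \o pi (c q)) z'| <= d^-1 * `|z - z'|).
    move=> q; have [_ oU KU hU _] := locU (c q).
    have near_lip := locally_lipschitz oU (@compact_cball _ _ _) KU hU.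
    exact: near_lip.
  exists d^-1, d => // q y z yK zK yz; apply: (Lip q z) => //.
  by rewrite subrr normr0 ltW.
- move=> eta eta0.
  have [|d d0 Flat] := Hd (fun d q => forall y, `|y - x (c q)| <= r (c q) ->
    exists w : 'rV[R]_m.+1, (exists j, `|w 0 j| = 1) /\
    forall z z', `|z - y| <= d -> `|z' - y| <= d ->
      `|\sum_l w 0 l * ((phi \o pi (c q)) z - (phi \o pi (c q)) z') 0 l|
        <= eta * `|z - z'|).
    move=> q; have [_ oU KU hU dJ] := locU (c q).
    have near_flat := locally_flat oU (@compact_cball _ _ _) KU hU eta0 dJ.
    exact: near_flat.
  exists d => // q y yK; have [w [wj Hw]] := Flat q y yK.
  by exists w; split=> // z z' _ _; exact: Hw.
exists z; split=> // p pz.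
have [q qs [u uK piu]] := cover_s p.
have [i iE] : exists i, q = c i by apply/(@tnthP _ _ t).
by apply: (zE i u); rewrite /= -iE // piu.
Unshelve. all: by end_near. Qed.

End MiniSard.

(** * Jacobians and charts *)

Section Jacobian.
Variable R : realType.

Lemma derive_mxE (V : normedModType R) m n (F : V -> 'M[R]_(m, n)) x v i j :
  differentiable F x -> ('D_v F x) i j = 'D_v (fun y => F y i j) x.
Proof.
move=> dF; rewrite -[LHS]/(mxcoord i j _).
by rewrite -(derive_linear_comp v (@mxcoord_continuous R m n i j) dF).
Qed.

Lemma differentiable_mxE (V : normedModType R) m n (F : V -> 'M[R]_(m, n)) x i j :
  differentiable F x -> differentiable (fun y => F y i j) x.
Proof.
by move=> dF; exact: (differentiable_comp dF (differentiable_coord (F x) i j)).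
Qed.

Lemma derive_sum_smul (V : normedModType R) (I : finType) (a : I -> R)
    (b : I -> V) (f : V -> R) x : differentiable f x ->
  'D_(\sum_i a i *: b i) f x = \sum_i a i * 'D_(b i) f x.
Proof.
move=> df; rewrite deriveE // linear_sum; apply: eq_bigr => i _.
by rewrite linearZ deriveE.
Qed.

Lemma derive_scalarM (V : normedModType R) (f g : V -> R) x v :
  differentiable f x -> differentiable g x ->
  'D_v (fun y => f y * g y) x = f x * 'D_v g x + g x * 'D_v f x.
Proof.
move=> df dg.
by rewrite -[fun y => _]/(f * g) deriveM //; apply: diff_derivable.
Qed.

Lemma derive_scalar_sum (V : normedModType R) (I : finType) (f : I -> V -> R)
    x v : (forall i, differentiable (f i) x) ->
  'D_v (fun y => \sum_i f i y) x = \sum_i 'D_v (f i) x /\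
  differentiable (fun y => \sum_i f i y) x.
Proof.
move=> df; elim: (index_enum I) => [|i s [IH1 IH2]].
  have -> : (fun y => \sum_(i <- [::]) f i y) = cst 0.
    by apply/funext => y; rewrite big_nil.
  by rewrite big_nil derive_cst; split=> //; exact: differentiable_cst.
have -> : (fun y => \sum_(j <- i :: s) f j y) =
    f i + (fun y => \sum_(j <- s) f j y).
  by apply/funext => y; rewrite big_cons.
split; last by apply: differentiableD.
by rewrite big_cons -IH1 deriveD //; apply: diff_derivable.
Qed.

Lemma differentiable_mx (V : normedModType R) m n (F : V -> 'M[R]_(m, n)) x :
  (forall i j, differentiable (fun y => F y i j) x) -> differentiable F x.
Proof.
move=> dF.
have -> : F = (fun y => \sum_(ij : 'I_m * 'I_n)
                 F y ij.1 ij.2 *: delta_mx ij.1 ij.2).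
  by apply/funext => y; rewrite {1}(matrix_sum_delta (F y)) pair_bigA.
elim: (index_enum _) => [|[i j] s IH].
  have -> : (fun y => \sum_(ij <- [::]) F y ij.1 ij.2 *: delta_mx ij.1 ij.2) =
      cst (0 : 'M[R]_(m, n)) by apply/funext => y; rewrite big_nil.
  exact: differentiable_cst.
have -> : (fun y => \sum_(ij <- (i, j) :: s) F y ij.1 ij.2 *: delta_mx ij.1 ij.2) =
    (fun y => F y i j *: (delta_mx i j : 'M[R]_(m, n))) +
    (fun y => \sum_(ij <- s) F y ij.1 ij.2 *: delta_mx ij.1 ij.2).
  by apply/funext => y; rewrite big_cons.
by apply: differentiableD => //; exact: differentiableZl.
Qed.

Lemma differentiable_mulmx (V : normedModType R) m n p (A : V -> 'M[R]_(m, n))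
    (B : V -> 'M[R]_(n, p)) x :
  differentiable A x -> differentiable B x ->
  differentiable (fun y => A y *m B y) x.
Proof.
move=> dA dB; apply: differentiable_mx => i j.
have -> : (fun y => (A y *m B y) i j) = (fun y => \sum_l A y i l * B y l j).
  by apply/funext => y; rewrite mxE.
have [l|//] := @derive_scalar_sum V _ (fun l y => A y i l * B y l j) x 0.
by apply: differentiableM; exact: differentiable_mxE.
Qed.

Lemma derive_mulmx (V : normedModType R) m n p (A : V -> 'M[R]_(m, n))
    (B : V -> 'M[R]_(n, p)) x v :
  differentiable A x -> differentiable B x ->
  'D_v (fun y => A y *m B y) x = 'D_v A x *m B x + A x *m 'D_v B x.
Proof.
move=> dA dB; apply/matrixP => i j.
rewrite (derive_mxE _ _ _ (differentiable_mulmx dA dB)).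
have -> : (fun y => (A y *m B y) i j) = (fun y => \sum_l A y i l * B y l j).
  by apply/funext => y; rewrite mxE.
have [l|-> _] := @derive_scalar_sum V _ (fun l y => A y i l * B y l j) x v.
  by apply: differentiableM; exact: differentiable_mxE.
rewrite !mxE -big_split; apply: eq_bigr => l _ /=.
rewrite derive_scalarM; try exact: differentiable_mxE.
by rewrite !derive_mxE // addrC [_ * B x l j]mulrC.
Qed.

Lemma derive_trmx (V : normedModType R) m n (A : V -> 'M[R]_(m, n)) x v :
  differentiable A x ->
  'D_v (fun y => (A y)^T) x = ('D_v A x)^T /\ differentiable (fun y => (A y)^T) x.
Proof.
move=> dA.
have E i j : (fun y => (A y)^T i j) = (fun y => A y j i).
  by apply/funext => y; rewrite mxE.
have dT : differentiable (fun y => (A y)^T) x.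
  by apply: differentiable_mx => i j; rewrite E; exact: differentiable_mxE.
split=> //; apply/matrixP => i j.
by rewrite derive_mxE // E mxE derive_mxE.
Qed.

Lemma jacobianE m n (f : 'rV[R]_m -> 'rV[R]_n) x i j : differentiable f x ->
  'J f x i j = ('D_(delta_mx 0 i) f x) 0 j.
Proof. by move=> df; rewrite deriveEjacobian // -rowE [RHS]mxE. Qed.

Lemma row_jacobian m n (f : 'rV[R]_m -> 'rV[R]_n) x i : differentiable f x ->
  row i ('J f x) = 'D_(delta_mx 0 i) f x.
Proof. by move=> df; rewrite rowE -deriveEjacobian. Qed.

Lemma jacobian_comp m n p (f : 'rV[R]_m -> 'rV[R]_n) (g : 'rV[R]_n -> 'rV[R]_p)
    x : differentiable f x -> differentiable g (f x) ->
  'J (g \o f) x = 'J f x *m 'J g (f x).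
Proof.
move=> df dg; have dgf := differentiable_comp df dg.
apply/row_matrixP => i; rewrite !rowE mulmxA.
rewrite -(deriveEjacobian _ dgf) -(deriveEjacobian _ df) -(deriveEjacobian _ dg).
by rewrite (deriveE _ dgf) (deriveE _ df) (deriveE _ dg) (diff_comp df dg).
Qed.

Lemma near_eq_jacobian m n (f g : 'rV[R]_m -> 'rV[R]_n) x :
  (\near x, f x = g x) -> differentiable f x -> 'J g x = 'J f x.
Proof.
move=> fg df; have dg := near_eq_differentiable fg df.
apply/row_matrixP => i; apply: (etrans (row_jacobian i dg)).
exact: (etrans (esym (near_eq_derive _ fg)) (esym (row_jacobian i df))).
Qed.

Lemma jacobian_id m (x : 'rV[R]_m) : 'J id x = 1%:M.
Proof.
apply/row_matrixP => i; rewrite rowE -deriveEjacobian // derive_id.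
by rewrite rowE mulmx1.
Qed.

Lemma derive_constant_line (V W : normedModType R) (f : V -> W) x v :
  (forall s : R, f (s *: v + x) = f x) -> 'D_v f x = 0.
Proof.
move=> fx; rewrite /derive.
have -> : (fun h : R => h^-1 *: ((f \o shift x) (h *: v) - f x)) = cst 0.
  by apply/funext => h /=; rewrite fx subrr scaler0.
exact: lim_cst.
Qed.

End Jacobian.

(* Unification would otherwise compare distinct derivatives by unfolding the
   choice operators in their definitions. *)
#[local] Opaque jacobian diff derive.

Section Charts.
Variables (R : realType).

Lemma open_nearP (T : topologicalType) (A : set T) :
  (forall x, A x -> nbhs x A) -> open A.
Proof. by move=> H; rewrite openE => x /H. Qed.

Lemma open_local_dom (T S : topologicalType) m p (f : T -> S)
    (c : chart R T m) (d : chart R S p) :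
  continuous f -> open (local_dom f c d).
Proof.
move=> cf; apply: open_nearP => u [cu du].
have nc : nbhs u (cod c) by apply: open_nbhs_nbhs; split=> //; exact: open_cod.
apply: filterI => //.
have cfp : {for u, continuous (f \o param c)}.
  by apply: continuous_comp; [exact: param_continuous|exact: cf].
by apply: cfp; apply: open_nbhs_nbhs; split=> //; exact: open_dom.
Qed.

Variables (T : topologicalType) (m : nat).
Implicit Types c d : chart R T m.

Lemma open_overlap c d : open (overlap c d).
Proof. by apply: open_local_dom => x A. Qed.

Lemma overlap_transition c d u : overlap c d u ->
  [/\ overlap d c (transition c d u), param d (transition c d u) = param c u
    & transition d c (transition c d u) = u].
Proof.
move=> [cu du]; rewrite /transition /local_rep /=.
have E : param d (coord d (param c u)) = param c u by rewrite coordK.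
split; rewrite ?E ?paramK //; split; first exact: coord_cod.
by rewrite /= E; exact: param_dom.
Qed.

Variable A : smooth_manifold R T m.

Lemma transition_smooth c d : atlas A c -> atlas A d ->
  smooth_on (overlap c d) (transition c d).
Proof. by move=> ac ad; have [] := atlas_compatible ac ad. Qed.

Lemma transition_differentiable c d u : atlas A c -> atlas A d ->
  overlap c d u -> differentiable (transition c d) u.
Proof.
by move=> ac ad; apply: smooth_on_differentiable; exact: transition_smooth.
Qed.

Lemma jacobian_transition c d u : atlas A c -> atlas A d -> overlap c d u ->
  'J (transition c d) u *m 'J (transition d c) (transition c d u) = 1%:M.
Proof.
move=> ac ad ov; have [ov' _ _] := overlap_transition ov.
rewrite -jacobian_comp; try exact: transition_differentiable.
rewrite -(jacobian_id u); apply: near_eq_jacobian => //.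
apply: near_open (@open_overlap c d) ov _ => v.
by move=> /overlap_transition[_ _ /= ->].
Qed.

Lemma jacobian_transition_unit c d u : atlas A c -> atlas A d ->
  overlap c d u -> 'J (transition c d) u \in unitmx.
Proof.
by move=> ac ad ov; have [J1 _] := mulmx1_unit (jacobian_transition ac ad ov).
Qed.

Definition smooth_fun n (h : T -> 'rV[R]_n) : Prop :=
  forall c, atlas A c -> smooth_on (cod c) (h \o param c).

(** The chart may vary with the point, because smooth transition maps compare it with every other
    chart of the atlas. *)
Lemma smooth_fun_local n (h : T -> 'rV[R]_n) :
  (forall p, exists c (U : set 'rV[R]_m),
     [/\ atlas A c, dom c p, open U, U (coord c p) & smooth_on U (h \o param c)]) ->
  smooth_fun h.
Proof.
move=> loc d ad; apply: smooth_on_local => u du.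
have [c [U [ac cp oU Uc sU]]] := loc (param d u).
pose U' := [set v | overlap d c v /\ U (transition d c v)].
have ovu : overlap d c u by [].
have oU' : open U'.
  apply: open_nearP => v [ov Uv]; apply: filterI.
    by apply: open_nbhs_nbhs; split=> //; exact: open_overlap.
  have /(_ U) := differentiable_continuous (transition_differentiable ad ac ov).
  by apply; apply: open_nbhs_nbhs.
exists U'; first by split.
apply: (@smooth_on_ext _ _ _ _ (fun v => (h \o param c) (transition d c v))) => //.
  by move=> v [/overlap_transition[_ /= -> _] _].
apply: (@smooth_on_comp _ _ _ _ _ _ U) => //; first by move=> v [].
by apply: smooth_on_sub (transition_smooth ad ac) => v [].
Qed.

End Charts.

(** * The flat trivialisation of the tangent bundle *)

Section Pairs.
Variable R : realType.

Lemma smooth_on_fst m n (U : set ('rV[R]_m * 'rV[R]_n)) : open U ->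
  smooth_on U (fun w : 'rV[R]_m * 'rV[R]_n => w.1).
Proof.
move=> oU k; apply: (@Ck_on_linear_comp _ _ _ _ _ _ fst id) => //.
  by move=> w; exact: cvg_fst.
exact: Ck_on_id.
Qed.

Lemma smooth_on_snd m n (U : set ('rV[R]_m * 'rV[R]_n)) : open U ->
  smooth_on U (fun w : 'rV[R]_m * 'rV[R]_n => w.2).
Proof.
move=> oU k; apply: (@Ck_on_linear_comp _ _ _ _ _ _ snd id) => //.
  by move=> w; exact: cvg_snd.
exact: Ck_on_id.
Qed.

Lemma derive_pair (V W X : normedModType R) (F : V * W -> X) (I : normedModType R)
    (a : I -> V) (b : I -> W) (t v : I) :
  differentiable F (a t, b t) -> differentiable a t -> differentiable b t ->
  differentiable (fun s => F (a s, b s)) t /\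
  'D_v (fun s => F (a s, b s)) t = 'D_('D_v a t, 'D_v b t) F (a t, b t).
Proof.
move=> dF da db; have dab := differentiable_pair da db.
have dc : differentiable (F \o (fun s => (a s, b s))) t.
  exact: differentiable_comp.
split; first exact: dc.
rewrite (deriveE v dc) (deriveE _ dF) (deriveE v da) (deriveE v db).
by rewrite (diff_comp dab dF) /= (diff_pair da db).
Qed.

Lemma derive_slice2 (V W X : normedModType R) (F : V * W -> X) x y v :
  differentiable F (x, y) -> 'D_v (fun s => F (x, s)) y = 'D_(0, v) F (x, y).
Proof.
move=> dF.
have [_ ->] := @derive_pair V W X F W (fun=> x) id y v dF
  (differentiable_cst _ _) (@ex_diff _ _ _ _ _ _ _ (is_diff_id y)).
by rewrite derive_cst derive_id.
Qed.

Lemma derive_slice1 (V W X : normedModType R) (F : V * W -> X) x y v :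
  differentiable F (x, y) -> 'D_v (fun s => F (s, y)) x = 'D_(v, 0) F (x, y).
Proof.
move=> dF.
have [_ ->] := @derive_pair V W X F V id (fun=> y) x v dF
  (@ex_diff _ _ _ _ _ _ _ (is_diff_id x)) (differentiable_cst _ _).
by rewrite derive_cst derive_id.
Qed.

Lemma near_preimage (T S : topologicalType) (g : T -> S) (x : T) (B : set S) :
  {for x, continuous g} -> open B -> B (g x) -> nbhs x (g @^-1` B).
Proof. by move=> cg oB Bx; apply: cg; exact: open_nbhs_nbhs. Qed.

End Pairs.

Section GroupOperation.
Variables (R : realType) (p : nat) (G : topologicalZmodType).
Variable AG : smooth_manifold R G p.
Hypothesis LG : commutative_lie_group AG.
Implicit Types c d e : chart R G p.

Definition group_op c d e (w : 'rV[R]_p * 'rV[R]_p) : 'rV[R]_p :=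
  coord e (param c w.1 + param d w.2).

Definition group_dom c d e : set ('rV[R]_p * 'rV[R]_p) :=
  [set w | cod c w.1 /\ cod d w.2 /\ dom e (param c w.1 + param d w.2)].

Lemma open_group_dom c d e : open (group_dom c d e).
Proof.
apply: open_nearP => w [cw [dw ew]].
have c1 : {for w, continuous (fun w : 'rV[R]_p * 'rV[R]_p => param c w.1)}.
  by apply: continuous_comp; [exact: cvg_fst|exact: param_continuous].
have c2 : {for w, continuous (fun w : 'rV[R]_p * 'rV[R]_p => param d w.2)}.
  by apply: continuous_comp; [exact: cvg_snd|exact: param_continuous].
apply: filterI.
  by apply: near_preimage cw; [exact: cvg_fst|exact: open_cod].
apply: filterI.
  by apply: near_preimage dw; [exact: cvg_snd|exact: open_cod].
apply: (@near_preimage _ _ (fun w : 'rV[R]_p * 'rV[R]_p =>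
  param c w.1 + param d w.2) w (dom e) _ _ ew); last exact: open_dom.
apply: (@continuous_comp _ _ _ (fun w : 'rV[R]_p * 'rV[R]_p =>
  (param c w.1, param d w.2)) (fun x : G * G => x.1 + x.2)).
  exact: cvg_pair.
exact: add_continuous.
Qed.

Lemma group_op_smooth c d e : atlas AG c -> atlas AG d -> atlas AG e ->
  smooth_on (group_dom c d e) (group_op c d e).
Proof. by case: LG => H _; exact: H. Qed.

(** Translation by [a] is the group operation with its first argument frozen at the coordinates of
    [a] in some chart. *)
Lemma translation_smooth (a : G) c d : atlas AG c -> atlas AG d ->
  smooth_on (local_dom (fun x => a + x) c d) (local_rep (fun x => a + x) c d).
Proof.
move=> ac ad; have [b ab ba] := atlas_cover AG a.
have cont : continuous (fun x : G => a + x).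
  move=> x; apply: (@continuous_comp _ _ _ (fun x : G => (a, x))
    (fun x : G * G => x.1 + x.2)); last exact: add_continuous.
  by apply: cvg_pair; [exact: cvg_cst|move=> B].
have oU := open_local_dom cont (c := c) (d := d).
have E v : local_rep (fun x => a + x) c d v =
    group_op b c d (coord b a, v) by rewrite /group_op /= coordK.
apply: (@smooth_on_ext _ _ _ _ (fun v => group_op b c d (coord b a, v))) => //.
apply: smooth_on_comp2 (group_op_smooth ab ac ad) _ => //.
- exact: open_group_dom.
- move=> v [cv dv]; split; first exact: coord_cod.
  by rewrite /= coordK.
- by apply: smooth_on_pair => //; [exact: smooth_on_cst|exact: smooth_on_id].
Qed.

End GroupOperation.

Section Frame.
Variables (R : realType) (p : nat) (G : topologicalZmodType).
Variable AG : smooth_manifold R G p.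
Hypothesis LG : commutative_lie_group AG.
Variables (e : chart R G p).
Hypotheses (ae : atlas AG e) (e0 : dom e 0).
Variables (m : nat) (M : topologicalType) (AM : smooth_manifold R M m).
Variable f : M -> G.
Hypothesis sf : smooth_map AM AG f.
Implicit Types c d : chart R M m.

Local Notation z0 := (coord e 0).

(** Subtraction moves every pair of nearby points to the origin, so the single chart [e] suffices,
    and translating a tangent vector to the origin becomes differentiation in the second variable on
    the diagonal. *)
Definition displacement c (w : 'rV[R]_m * 'rV[R]_m) : 'rV[R]_p :=
  coord e (f (param c w.2) - f (param c w.1)).

Definition displacement_dom c : set ('rV[R]_m * 'rV[R]_m) :=
  [set w | cod c w.1 /\ cod c w.2 /\ dom e (f (param c w.2) - f (param c w.1))].

Lemma open_displacement_dom c : open (displacement_dom c).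
Proof.
apply: open_nearP => w [cw [dw ew]].
have [cf _] := sf.
have c1 : {for w, continuous (fun w : 'rV[R]_m * 'rV[R]_m => f (param c w.1))}.
  apply: (@continuous_comp _ _ _ (fun w : 'rV[R]_m * 'rV[R]_m => param c w.1) f).
    by apply: continuous_comp; [exact: cvg_fst|exact: param_continuous].
  exact: cf.
have c2 : {for w, continuous (fun w : 'rV[R]_m * 'rV[R]_m => f (param c w.2))}.
  apply: (@continuous_comp _ _ _ (fun w : 'rV[R]_m * 'rV[R]_m => param c w.2) f).
    by apply: continuous_comp; [exact: cvg_snd|exact: param_continuous].
  exact: cf.
apply: filterI.
  by apply: near_preimage cw; [exact: cvg_fst|exact: open_cod].
apply: filterI.
  by apply: near_preimage dw; [exact: cvg_snd|exact: open_cod].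
apply: (@near_preimage _ _ (fun w : 'rV[R]_m * 'rV[R]_m =>
  f (param c w.2) - f (param c w.1)) w (dom e) _ _ ew); last exact: open_dom.
apply: (@continuous_comp _ _ _ (fun w : 'rV[R]_m * 'rV[R]_m =>
  (f (param c w.2), f (param c w.1))) (fun x : G * G => x.1 - x.2)).
  exact: cvg_pair.
exact: sub_continuous.
Qed.

Lemma displacement_diag c u : cod c u ->
  displacement_dom c (u, u) /\ displacement c (u, u) = z0.
Proof.
move=> cu; split; last by rewrite /displacement subrr.
by split=> //; split=> //=; rewrite subrr.
Qed.

(** The map is composed of [f], negation and the group operation, each smooth only in charts; [d],
    [d1] and [d2] are charts around [f v], [f u] and [- f u] for the given pair of points. *)
Lemma displacement_smooth c : atlas AM c ->
  smooth_on (displacement_dom c) (displacement c).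
Proof.
move=> ac; have [cf sfcd] := sf; have [_ [cN sN]] := LG.
apply: smooth_on_local => -[u0 v0] [/= cu0 [cv0 ew0]].
have [d ad dv0] := atlas_cover AG (f (param c v0)).
have [d1 ad1 du0] := atlas_cover AG (f (param c u0)).
have [d2 ad2 dNu0] := atlas_cover AG (- f (param c u0)).
pose U := [set w : 'rV[R]_m * 'rV[R]_m |
  [/\ local_dom f c d w.2, local_dom f c d1 w.1,
      local_dom (fun x => - x) d1 d2 (local_rep f c d1 w.1) &
      displacement_dom c w]].
have oU : open U.
  apply: open_nearP => w [w1 w2 w3 w4].
  have n1 : nbhs w [set w : 'rV[R]_m * 'rV[R]_m | local_dom f c d w.2].
    by apply: near_preimage w1; [exact: cvg_snd|exact: open_local_dom].
  have n2 : nbhs w [set w : 'rV[R]_m * 'rV[R]_m | local_dom f c d1 w.1].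
    by apply: near_preimage w2; [exact: cvg_fst|exact: open_local_dom].
  have n3 : nbhs w [set w : 'rV[R]_m * 'rV[R]_m |
      local_dom (fun x => - x) d1 d2 (local_rep f c d1 w.1)].
    apply: (@near_preimage _ _ (fun w : 'rV[R]_m * 'rV[R]_m =>
      local_rep f c d1 w.1) w _ _ _ w3); last exact: open_local_dom.
    apply: (@continuous_comp _ _ _ (fun w : 'rV[R]_m * 'rV[R]_m => w.1)
      (local_rep f c d1)); first exact: cvg_fst.
    exact: (smooth_on_continuous (sfcd _ _ ac ad1)).
  have n4 : nbhs w (displacement_dom c).
    by apply: open_nbhs_nbhs; split=> //; exact: open_displacement_dom.
  near=> v; split; near: v; [exact: n1|exact: n2|exact: n3|exact: n4].
exists U.
  split=> //=; split; first exact: coord_cod.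
  by rewrite /= /local_rep coordK.
apply: (@smooth_on_ext _ _ _ _ (fun w => group_op d d2 e
   (local_rep f c d w.2,
    local_rep (fun x => - x) d1 d2 (local_rep f c d1 w.1)))) => //.
  move=> w [[_ /= H1] [_ /= H2] [_ /= H3] _].
  by rewrite /group_op /displacement /= /local_rep coordK // coordK // coordK.
apply: smooth_on_comp2 (group_op_smooth LG ad ad2 ae) _ => //.
- exact: open_group_dom.
- move=> w [[h1 /= H1] [h2 /= H2] [h3 /= H3] [_ [_ h4]]].
  split; first by exact: coord_cod.
  split; first exact: coord_cod.
  by rewrite /= /local_rep coordK // coordK // coordK.
- apply: smooth_on_pair => //.
    apply: (@smooth_on_comp _ _ _ _ _ _ (local_dom f c d)) => //.
    + exact: open_local_dom.
    + by move=> w [].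
    + exact: sfcd.
    + exact: smooth_on_snd.
  apply: (@smooth_on_comp _ _ _ _ _ _ (local_dom (fun x => - x) d1 d2)) => //.
  + exact: open_local_dom.
  + by move=> w [].
  + exact: sN.
  apply: (@smooth_on_comp _ _ _ _ _ _ (local_dom f c d1)) => //.
  + exact: open_local_dom.
  + by move=> w [].
  + exact: sfcd.
  + exact: smooth_on_fst.
Unshelve. all: by end_near. Qed.

Lemma displacement_differentiable c w : atlas AM c -> displacement_dom c w ->
  differentiable (displacement c) w.
Proof.
by move=> ac; apply: smooth_on_differentiable; exact: displacement_smooth.
Qed.

Lemma slice_differentiable c u v : atlas AM c -> displacement_dom c (u, v) ->
  differentiable (fun s => displacement c (u, s)) v.
Proof.
move=> ac uv.
have dd := displacement_differentiable ac uv.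
by have [] := @derive_pair R _ _ _ (displacement c) _ (fun=> u) id v 0 dd
  (differentiable_cst _ _) (@ex_diff _ _ _ _ _ _ _ (is_diff_id v)).
Qed.

(* The differential of [f] followed by the translation of the tangent spaces of
   the group to the origin. *)
Definition frame c (u : 'rV[R]_m) : 'M[R]_(m, p) :=
  'J (fun v => displacement c (u, v)) u.

Lemma row_frame c u i : atlas AM c -> cod c u ->
  row i (frame c u) = 'D_(delta_mx 0 i) (fun v => displacement c (u, v)) u.
Proof.
move=> ac cu; apply: row_jacobian; apply: slice_differentiable => //.
by case: (displacement_diag cu).
Qed.

(** The base point of the slice moves with [u], so a partial derivative of the map of two variables
    is taken first and restricted to the diagonal afterwards. *)
Lemma frame_smooth c : atlas AM c -> smooth_on (cod c) (frame c).
Proof.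
move=> ac; have oc := open_cod (c := c).
apply: smooth_on_mx => // i j.
apply: (@smooth_on_ext _ _ _ _ (fun u =>
  ('D_(0, delta_mx 0 i) (displacement c) (u, u)) 0 j)) => //.
  move=> u cu; have [dud _] := displacement_diag cu.
  have -> : frame c u i j = (row i (frame c u)) 0 j by rewrite [RHS]mxE.
  have dd := displacement_differentiable ac dud.
  by rewrite (row_frame i ac cu) (derive_slice2 _ dd).
apply: smooth_on_coord => //.
apply: (@smooth_on_comp2 _ _ _ _ _ _ _ (displacement_dom c)
  ('D_(0, delta_mx 0 i) (displacement c)) (fun u => (u, u))) => //.
- exact: open_displacement_dom.
- by move=> u cu; case: (displacement_diag cu).
- by apply: smooth_on_derive; exact: displacement_smooth.
- by apply: smooth_on_pair => //; exact: smooth_on_id.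
Qed.

Lemma frame_change c d u : atlas AM c -> atlas AM d -> overlap c d u ->
  frame c u = 'J (transition c d) u *m frame d (transition c d u).
Proof.
move=> ac ad ov; have [[dt _] pt _] := overlap_transition ov.
have [dd _] := displacement_diag dt.
have ds := slice_differentiable ad dd.
have dt' := transition_differentiable ac ad ov.
have nE : \forall w \near u, ((fun v => displacement d (transition c d u, v)) \o
    transition c d) w = displacement c (u, w).
  apply: near_open (@open_overlap _ _ _ c d) ov _ => v.
  by move=> /overlap_transition[_ pv _]; rewrite /displacement /= pt pv.
exact: (etrans (near_eq_jacobian nE (differentiable_comp dt' ds))
               (jacobian_comp dt' ds)).
Qed.

(** Near [u] the displacement from [u] is [f] followed by the left translation by [- f u]. Both
    preserve the metrics, so the metric of [M] is the pullback of one fixed inner product at the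
    origin. *)
Lemma frame_metric (gG : riemannian_metric AG) (gM : riemannian_metric AM) c u :
  left_invariant gG -> isometric gM gG f -> atlas AM c -> cod c u ->
  gM c u = frame c u *m gG e z0 *m (frame c u)^T.
Proof.
move=> lG iso ac cu; have [cf sfcd] := sf.
have [d ad du] := atlas_cover AG (f (param c u)).
have lu : local_dom f c d u by [].
set a := - f (param c u).
have lw : local_dom (fun x => a + x) d e (local_rep f c d u).
  split; first exact: coord_cod.
  by rewrite /local_rep /= coordK // /a addNr.
have wE : local_rep (fun x => a + x) d e (local_rep f c d u) = z0.
  by rewrite /local_rep coordK // /a addNr.
have FE : frame c u = 'J (local_rep f c d) u *m
    'J (local_rep (fun x => a + x) d e) (local_rep f c d u).
  have df : differentiable (local_rep f c d) u.
    exact: (smooth_on_differentiable (sfcd _ _ ac ad)).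
  have dt : differentiable (local_rep (fun x => a + x) d e) (local_rep f c d u).
    exact: (smooth_on_differentiable (translation_smooth LG a ad ae)).
  have nE : \forall v \near u, (local_rep (fun x => a + x) d e \o
      local_rep f c d) v = displacement c (u, v).
    apply: near_open (open_local_dom cf (c := c) (d := d)) lu _ => v [cv dv].
    by rewrite /= /local_rep /displacement /= coordK // addrC.
  exact: (etrans (near_eq_jacobian nE (differentiable_comp df dt))
                 (jacobian_comp df dt)).
by rewrite FE (iso c d u ac ad lu) (lG a d e _ ad ae lw) wE trmx_mul !mulmxA.
Qed.

End Frame.

(** * Closedness of the form defined by a commutative local group law *)

Section Closed.
Variable R : realType.

Lemma differentiable_fst_snd (V W : normedModType R) (x : V * W) :
  differentiable (fst : V * W -> V) x /\ differentiable (snd : V * W -> W) x.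
Proof.
split; apply: linear_differentiable => w; first exact: cvg_fst.
exact: cvg_snd.
Qed.

Lemma swap_continuous (V W : normedModType R) (x : V * W) :
  {for x, continuous (fun w : V * W => (w.2, w.1))}.
Proof.
have [d1 d2] := differentiable_fst_snd x.
exact: (differentiable_continuous (differentiable_pair d2 d1)).
Qed.

Lemma derive_swap (V W X : normedModType R) (F : W * V -> X) (x : V * W) v :
  differentiable F (x.2, x.1) ->
  'D_v (fun w => F (w.2, w.1)) x = 'D_(v.2, v.1) F (x.2, x.1).
Proof.
move=> dF.
have [d1 d2] := differentiable_fst_snd x.
have c1 : continuous (fst : V * W -> V) by move=> w; exact: cvg_fst.
have c2 : continuous (snd : V * W -> W) by move=> w; exact: cvg_snd.
have did := @ex_diff _ _ _ _ _ _ _ (is_diff_id x).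
have [_ ->] := @derive_pair R W V X F (V * W)%type snd fst x v dF d2 d1.
have := @derive_linear_comp R _ _ _ fst id x v c1 did.
have := @derive_linear_comp R _ _ _ snd id x v c2 did.
by rewrite derive_id => <- <-.
Qed.

(** In the application [F] is the group law near the identity [z0], [E] the matrix of the translated
    differential and [psi] the displacement from [u0]. Then [psiE] says that the differential of
    [psi] at [u] is [E u], translated from the identity to [psi u]. *)
Variables (m p : nat) (E : 'rV[R]_m -> 'M[R]_(m, p)).
Variables (psi : 'rV[R]_m -> 'rV[R]_p) (F : 'rV[R]_p * 'rV[R]_p -> 'rV[R]_p).
Variables (u0 : 'rV[R]_m) (z0 : 'rV[R]_p).
Variables (U : set 'rV[R]_m) (W : set ('rV[R]_p * 'rV[R]_p)).
Hypotheses (oU : open U) (oW : open W) (Uu0 : U u0) (Wz0 : W (z0, z0)).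
Hypotheses (sE : smooth_on U E) (spsi : smooth_on U psi) (sF : smooth_on W F).
Hypothesis psi0 : psi u0 = z0.
Hypothesis psiE : \forall u \near u0, W (z0, psi u) /\
  forall j, 'D_(delta_mx 0 j) psi u = 'D_(row j (E u), 0) F (z0, psi u).
Hypothesis F_unit : \forall x \near z0, F (x, z0) = x.
Hypothesis FC : \forall w \near (z0, z0), F (w.2, w.1) = F w.

Let dx (k : 'I_p) : 'rV[R]_p * 'rV[R]_p := (delta_mx 0 k, 0).
Let dy (k : 'I_p) : 'rV[R]_p * 'rV[R]_p := (0, delta_mx 0 k).

Let sum_dx (a : 'rV[R]_p) : (a, 0 : 'rV[R]_p) = \sum_k a 0 k *: dx k.
Proof.
rewrite {1}(pair_basisE (a, 0 : 'rV[R]_p)) big_sumType /=.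
rewrite [X in _ + X]big1 ?addr0 // => i _.
by rewrite mxE scale0r.
Qed.

Let sum_dy (a : 'rV[R]_p) : (0 : 'rV[R]_p, a) = \sum_k a 0 k *: dy k.
Proof.
rewrite {1}(pair_basisE (0 : 'rV[R]_p, a)) big_sumType /=.
rewrite [X in X + _]big1 ?add0r // => i _.
by rewrite mxE scale0r.
Qed.

Let psi_diff0 : differentiable psi u0.
Proof. exact: smooth_on_differentiable spsi Uu0. Qed.

Let F_diff w : W w -> differentiable F w.
Proof. exact: smooth_on_differentiable. Qed.

Let derive_F_unit v : 'D_(v, 0) F (z0, z0) = v.
Proof.
rewrite -(derive_slice1 v (F_diff Wz0)).
have nE : \forall s \near z0, (fun s => F (s, z0)) s = id s by exact: F_unit.
by rewrite (near_eq_derive v nE) derive_id.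
Qed.

Let derive_psi0 j : 'D_(delta_mx 0 j) psi u0 = row j (E u0).
Proof.
have [_ /(_ j) ->] := nbhs_singleton psiE.
by rewrite psi0 derive_F_unit.
Qed.

Section Component.
Variable q : 'I_p.

Let Fq w : R := F w 0 q.
Let sFq : smooth_on W Fq.
Proof. exact: smooth_on_coord. Qed.

Let a k y := 'D_(dx k) Fq (z0, y).
Let B k l := 'D_(dy l) ('D_(dx k) Fq) (z0, z0).

Let dFx_diff k w : W w -> differentiable ('D_(dx k) Fq) w.
Proof. by apply: smooth_on_differentiable; exact: smooth_on_derive. Qed.

(** Commutativity interchanges the two variables of [F] and Schwarz's theorem the two derivatives.
    For a general group law the antisymmetric part of [B] would be the Lie bracket. *)
Let B_sym k l : B k l = B l k.
Proof.
apply: etrans (schwarz (dy l) (dx k) oW Wz0 (sFq 2)) _.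
have nW : \forall w \near (z0, z0), W w by exact: open_nbhs_nbhs.
have nE : \forall w \near (z0, z0),
    'D_(dy l) Fq w = 'D_(dx l) Fq (w.2, w.1).
  have nE' := near_join (filterI nW FC).
  have nS : \forall w \near (z0, z0), W (w.2, w.1).
    apply: (@near_preimage _ _ (fun w : 'rV[R]_p * 'rV[R]_p => (w.2, w.1))) => //.
    exact: swap_continuous.
  near=> w.
  have Ww : W (w.2, w.1) by near: w; exact: nS.
  have FCw : \forall y \near w, Fq y = Fq (y.2, y.1).
    have : \forall y \near w, W y /\ F (y.2, y.1) = F y by near: w; exact: nE'.
    by apply: filterS => y [_ Ey]; rewrite /Fq Ey.
  rewrite (near_eq_derive (dy l) FCw) derive_swap //.
  exact: smooth_on_differentiable Ww.
apply: etrans (near_eq_derive (dx k) nE) _.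
exact: (@derive_swap _ _ _ ('D_(dx l) Fq) (z0, z0) (dx k) (dFx_diff l Wz0)).
Unshelve. all: by end_near. Qed.

Let psiq_derive j : \forall u \near u0,
  'D_(delta_mx 0 j) (fun u => psi u 0 q) u = \sum_k E u j k * a k (psi u).
Proof.
have nU : \forall u \near u0, U u by exact: open_nbhs_nbhs.
near=> u.
have Uu : U u by near: u.
have [Wu /(_ j) Du] : W (z0, psi u) /\
    forall j, 'D_(delta_mx 0 j) psi u = 'D_(row j (E u), 0) F (z0, psi u).
  by near: u.
have dpsi : differentiable psi u by exact: smooth_on_differentiable spsi Uu.
rewrite -(derive_mxE _ _ _ dpsi) Du (derive_mxE _ _ _ (F_diff Wu)) sum_dx.
rewrite derive_sum_smul; last exact: smooth_on_differentiable sFq Wu.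
by apply: eq_bigr => k _; rewrite mxE.
Unshelve. all: by end_near. Qed.

Let a_psi_derive k i :
  differentiable (fun u => a k (psi u)) u0 /\
  'D_(delta_mx 0 i) (fun u => a k (psi u)) u0 = \sum_l E u0 i l * B k l.
Proof.
have dFx : differentiable ('D_(dx k) Fq) (z0, psi u0).
  by rewrite psi0; exact: dFx_diff.
have [dc ->] := @derive_pair R _ _ _ ('D_(dx k) Fq) _ (fun=> z0) psi u0
  (delta_mx 0 i) dFx (differentiable_cst _ _) psi_diff0.
split=> //; rewrite derive_cst derive_psi0 psi0 sum_dy derive_sum_smul.
  by apply: eq_bigr => l _; rewrite mxE.
exact: dFx_diff.
Qed.

Let a_unit k : a k z0 = (k == q)%:R.
Proof.
rewrite /a -(derive_mxE _ _ _ (F_diff Wz0)) derive_F_unit mxE eqxx.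
by rewrite eq_sym.
Qed.

Let E_diff j k : differentiable (fun u => E u j k) u0.
Proof.
by apply: differentiable_mxE; exact: smooth_on_differentiable sE Uu0.
Qed.

(** The product rule for [psiq_derive]. At [u0] the coefficients [a k] are those of the identity,
    and their derivatives contribute the term in [B]. *)
Let second_derivative i j :
  'D_(delta_mx 0 i) ('D_(delta_mx 0 j) (fun u => psi u 0 q)) u0 =
  'D_(delta_mx 0 i) (fun u => E u j q) u0 +
  \sum_k \sum_l E u0 j k * E u0 i l * B k l.
Proof.
rewrite (near_eq_derive _ (psiq_derive j)).
have [k|-> _] := @derive_scalar_sum R _ _ (fun k u => E u j k * a k (psi u)) u0
    (delta_mx 0 i).
  by apply: differentiableM => //; case: (a_psi_derive k i).
rewrite [X in _ = X + _](_ : _ =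
    \sum_k (k == q)%:R * 'D_(delta_mx 0 i) (fun u => E u j k) u0); last first.
  rewrite (bigD1 q) //= eqxx mul1r big1 ?addr0 // => k /negPf ->.
  by rewrite mul0r.
rewrite -big_split; apply: eq_bigr => k _ /=.
have [da Da] := a_psi_derive k i.
rewrite derive_scalarM // Da psi0 a_unit addrC; congr (_ + _).
by rewrite mulr_sumr; apply: eq_bigr => l _; rewrite mulrA.
Qed.

(** In [second_derivative] the left side is symmetric in [i] and [j] by Schwarz's theorem and the
    quadratic term by [B_sym]; the remaining term must be symmetric as well. *)
Lemma closed_component i j :
  'D_(delta_mx 0 i) (fun u => E u j q) u0 =
  'D_(delta_mx 0 j) (fun u => E u i q) u0.
Proof.
have spsiq : smooth_on U (fun u => psi u 0 q) by exact: smooth_on_coord.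
have sym : \sum_k \sum_l E u0 i k * E u0 j l * B k l =
    \sum_k \sum_l E u0 j k * E u0 i l * B k l.
  rewrite exchange_big; apply: eq_bigr => k _; apply: eq_bigr => l _ /=.
  by rewrite B_sym [E u0 i l * _]mulrC.
have := second_derivative j i; rewrite sym => H.
exact: (addIr _ (etrans (esym (second_derivative i j)) (etrans
  (schwarz (delta_mx 0 i) (delta_mx 0 j) oU Uu0 (spsiq 2)) H))).
Qed.

End Component.

Lemma closed_rows i j :
  row j ('D_(delta_mx 0 i) E u0) = row i ('D_(delta_mx 0 j) E u0).
Proof.
have dE : differentiable E u0 by exact: smooth_on_differentiable sE Uu0.
apply/rowP => q; rewrite [LHS]mxE [RHS]mxE !(derive_mxE _ _ _ dE).
exact: closed_component.
Qed.

End Closed.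

Section FrameClosed.
Variables (R : realType) (p : nat) (G : topologicalZmodType).
Variable AG : smooth_manifold R G p.
Hypothesis LG : commutative_lie_group AG.
Variables (e : chart R G p).
Hypotheses (ae : atlas AG e) (e0 : dom e 0).
Variables (m : nat) (M : topologicalType) (AM : smooth_manifold R M m).
Variable f : M -> G.
Hypothesis sf : smooth_map AM AG f.
Implicit Types c d : chart R M m.

(* Commutativity makes the pulled back Maurer-Cartan form closed: with [u0]
   fixed, [f v - f u0 = (f v - f u) + (f u - f u0)] relates [frame] to the
   differential of the single map [displacement c (u0, _)]. *)
Lemma frame_closed c u0 i j : atlas AM c -> cod c u0 ->
  row j ('D_(delta_mx 0 i) (frame e f c) u0) =
  row i ('D_(delta_mx 0 j) (frame e f c) u0).
Proof.
move=> ac cu0.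
have [du0 z0E] := displacement_diag e0 f cu0.
set z0 := coord e 0 in z0E.
have ez0 : cod e z0 by exact: coord_cod.
have pz0 : param e z0 = 0 by rewrite coordK.
pose U := [set u | displacement_dom e f c (u0, u)].
have oU : open U.
  apply: open_nearP => u Uu.
  apply: (@near_preimage _ _ (fun u => (u0, u))) => //.
    have did := @ex_diff _ _ _ _ _ _ _ (is_diff_id u).
    exact: (differentiable_continuous
      (differentiable_pair (differentiable_cst u0 u) did)).
  exact: (open_displacement_dom sf).
have spsi : smooth_on U (fun u => displacement e f c (u0, u)).
  apply: (@smooth_on_comp2 _ _ _ _ _ _ _ (displacement_dom e f c)
    (displacement e f c) (fun u => (u0, u))) => //.
  - exact: (open_displacement_dom sf).
  - exact: (displacement_smooth LG ae sf).
  - by apply: smooth_on_pair => //; [exact: smooth_on_cst|exact: smooth_on_id].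
have Wz0 : group_dom e e e (z0, z0).
  by split=> //; split=> //=; rewrite pz0 addr0.
apply: (@closed_rows R m p (frame e f c) (fun u => displacement e f c (u0, u))
  (group_op e e e) u0 z0 U (group_dom e e e)) => //.
- exact: open_group_dom.
- apply: smooth_on_sub (frame_smooth LG ae e0 sf ac) => u [_ [cu _]].
  exact: cu.
- exact: (group_op_smooth LG).
- have nU : \forall u \near u0, U u by exact: open_nbhs_nbhs.
  have nW : \forall u \near u0, group_dom e e e (z0, displacement e f c (u0, u)).
    apply: (@near_preimage _ _ (fun u => (z0, displacement e f c (u0, u)))).
    + have dpsi := smooth_on_differentiable spsi du0.
      exact: (differentiable_continuous
        (differentiable_pair (differentiable_cst z0 u0) dpsi)).
    + exact: open_group_dom.
    + by rewrite z0E.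
  near=> u.
  have Uu : U u by near: u.
  have Wu : group_dom e e e (z0, displacement e f c (u0, u)) by near: u.
  split=> // j'.
  have [_ [cu eu]] := Uu.
  have [duu zE] := displacement_diag e0 f cu.
  have dsl := slice_differentiable LG ae sf ac duu.
  rewrite (row_frame LG ae e0 sf j' ac cu).
  have dF : differentiable (group_op e e e)
      (displacement e f c (u, u), displacement e f c (u0, u)).
    rewrite zE; apply: smooth_on_differentiable Wu; exact: (group_op_smooth LG).
  have [_ DF] := @derive_pair R _ _ _ (group_op e e e) _
    (fun v => displacement e f c (u, v)) (fun=> displacement e f c (u0, u))
    u (delta_mx 0 j') dF dsl (differentiable_cst _ _).
  rewrite derive_cst zE in DF; rewrite -DF; apply: near_eq_derive.
  have n1 : \forall v \near u, displacement_dom e f c (u, v).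
    apply: (@near_preimage _ _ (fun v => (u, v))) => //.
      have did := @ex_diff _ _ _ _ _ _ _ (is_diff_id u).
      exact: (differentiable_continuous
        (differentiable_pair (differentiable_cst u u) did)).
    exact: (open_displacement_dom sf).
  near=> v.
  have [_ [_ /= ev]] : displacement_dom e f c (u, v) by near: v.
  rewrite /group_op /displacement /= coordK // coordK //.
  by rewrite addrA subrK.
- have nz : \forall x \near z0, cod e x.
    by apply: open_nbhs_nbhs; split=> //; exact: open_cod.
  apply: filterS nz => x ex.
  by rewrite /group_op /= pz0 addr0 paramK.
- by near=> w; rewrite /group_op /= addrC.
Unshelve. all: by end_near. Qed.

End FrameClosed.

(** * The Levi-Civita connection of a metric induced by a closed frame *)

Section Covariant.
Variables (R : realType) (m p : nat) (T : topologicalType).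
Variables (A : smooth_manifold R T m) (g : riemannian_metric A).
Variables (c : chart R T m) (u : 'rV[R]_m).
Variables (E : 'rV[R]_m -> 'M[R]_(m, p)) (S : 'M[R]_p).
Hypothesis gE : \forall v \near u, g c v = E v *m S *m (E v)^T.
Hypothesis ST : S^T = S.
Hypothesis dE : differentiable E u.
Hypothesis E_closed : forall i j,
  row j ('D_(delta_mx 0 i) E u) = row i ('D_(delta_mx 0 j) E u).
Hypothesis g_unit : g c u \in unitmx.

(** The Christoffel symbols of the first kind: the entry at [j], [l] pairs the [i]-th derivative of
    row [j] of [E] with row [l]. Closedness is their symmetry in [i] and [j]. *)
Let Q i : 'M[R]_m := 'D_(delta_mx 0 i) E u *m S *m (E u)^T.

Let Q_sym i j l : Q i j l = Q j i l.
Proof.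
have QE a b : Q a b l = (row b ('D_(delta_mx 0 a) E u) *m (S *m (E u)^T)) 0 l.
  by rewrite -row_mul mulmxA [RHS]mxE.
have EC := congr1 (fun r => (r *m (S *m (E u)^T)) 0 l) (E_closed i j).
exact: (etrans (QE i j) (etrans EC (esym (QE j i)))).
Qed.

Let dgramE i j l : dgram g c u i j l = Q i j l + Q i l j.
Proof.
have [DT dT] := derive_trmx (delta_mx 0 i) dE.
have dS : differentiable (fun=> S : 'M[R]_p) u by exact: differentiable_cst.
have dES := differentiable_mulmx dE dS.
have dall := differentiable_mulmx dES dT.
have nE : \forall v \near u, g c v j l = (E v *m S *m (E v)^T) j l.
  by apply: filterS gE => v ->.
apply: (etrans (near_eq_derive _ nE)).
rewrite -(derive_mxE _ _ _ dall) (derive_mulmx _ dES dT) (derive_mulmx _ dE dS).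
rewrite derive_cst mulmx0 addr0 DT mxE; congr (_ + _).
have -> : E u *m S *m ('D_(delta_mx 0 i) E u)^T = (Q i)^T.
  by rewrite /Q !trmx_mul trmxK ST mulmxA.
by rewrite mxE.
Qed.

(** The three derivatives of the metric are six values of [Q]; by [Q_sym] four of them cancel and
    the other two coincide. *)
Let christoffelE i j k :
  christoffel g c u i j k = \sum_l invmx (g c u) k l * Q i j l.
Proof.
rewrite /christoffel mulr_sumr; apply: eq_bigr => l _.
have key (q : 'I_m -> 'I_m -> 'I_m -> R) : (forall a b d, q a b d = q b a d) ->
    (q i j l + q i l j) + (q j i l + q j l i) - (q l i j + q l j i) =
    2 * q i j l.
  by move=> qs; rewrite (qs j i l) (qs l i j) (qs l j i); ring.
have -> : dgram g c u i j l + dgram g c u j i l - dgram g c u l i j =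
    2 * Q i j l.
  apply: etrans (key (fun a b d => Q a b d) Q_sym).
  exact: (f_equal2 (fun x y => x - y)
    (f_equal2 +%R (dgramE i j l) (dgramE j i l)) (dgramE l i j)).
by rewrite mulrCA mulKf // pnatr_eq0.
Qed.

Let g_sym : (g c u)^T = g c u.
Proof. by rewrite (nbhs_singleton gE) !trmx_mul trmxK ST mulmxA. Qed.

(** The right side gives the components of the orthogonal projection of the derivative of
    [N c v *m E v] to the row space of [E u]. In the product rule the derivative of [N] is the flat
    part and that of [E] the Christoffel part. *)
Lemma covariant_derivative_frame X (N : chart R T m -> 'rV[R]_m -> 'rV[R]_m) :
  differentiable (N c) u ->
  covariant_derivative g c u X N =
  'D_X (fun v => N c v *m E v) u *m S *m (E u)^T *m invmx (g c u).
Proof.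
move=> dN; rewrite (derive_mulmx _ dN dE) !mulmxDl.
rewrite /covariant_derivative; congr (_ + _).
  rewrite -[_ *m E u *m S]mulmxA -[_ *m (E u *m S) *m _]mulmxA.
  by rewrite -(nbhs_singleton gE) mulmxK.
have -> : 'D_X E u = \sum_i X 0 i *: 'D_(delta_mx 0 i) E u.
  rewrite (deriveE X dE) {1}[X]row_sum_delta linear_sum.
  by apply: eq_bigr => i _; rewrite linearZ (deriveE _ dE).
have -> : N c u *m (\sum_i X 0 i *: 'D_(delta_mx 0 i) E u) *m S *m (E u)^T *m
    invmx (g c u) = \sum_i X 0 i *: (N c u *m Q i *m invmx (g c u)).
  rewrite mulmx_sumr !mulmx_suml; apply: eq_bigr => i _.
  by rewrite /Q -!scalemxAr -!scalemxAl !mulmxA.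
have gi_sym : (invmx (g c u))^T = invmx (g c u) by rewrite trmx_inv g_sym.
apply/rowP => k; rewrite mxE summxE; apply: eq_bigr => i _.
rewrite !mxE mulr_sumr.
transitivity (\sum_j \sum_l X 0 i * (N c u 0 j * Q i j l * invmx (g c u) l k)).
  apply: eq_bigr => j _; rewrite christoffelE !mulr_suml.
  apply: eq_bigr => l _.
  have -> : invmx (g c u) k l = invmx (g c u) l k.
    by rewrite -{1}gi_sym mxE.
  ring.
rewrite exchange_big; apply: eq_bigr => l _.
by rewrite -mulr_sumr mxE mulr_suml.
Qed.

End Covariant.

(** * Euclidean linear algebra *)

Section InnerProduct.
Variables (R : realType) (n : nat) (S : 'M[R]_n).

Definition ip (x y : 'rV[R]_n) : R := (x *m S *m y^T) 0 0.

Definition normalise (x : 'rV[R]_n) : 'rV[R]_n := (Num.sqrt (ip x x))^-1 *: x.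

(* Acting on row vectors from the right, the reflection in the hyperplane
   orthogonal to [v]. *)
Definition refl (v : 'rV[R]_n) : 'M[R]_n :=
  1%:M - (2 / ip v v) *: (S *m v^T *m v).

Hypothesis ST : S^T = S.
Hypothesis S_pos : forall x : 'rV[R]_n, x != 0 -> 0 < ip x x.

Lemma ipE x y : x *m S *m y^T = (ip x y)%:M.
Proof. exact: mx11_scalar. Qed.

Lemma ipC x y : ip x y = ip y x.
Proof.
rewrite /ip -[in LHS](trmxK (x *m S *m y^T)) mxE !trmx_mul trmxK ST.
by rewrite mulmxA.
Qed.

Lemma ipDl x y z : ip (x + y) z = ip x z + ip y z.
Proof. by rewrite /ip !mulmxDl mxE. Qed.

Lemma ipZl a x z : ip (a *: x) z = a * ip x z.
Proof. by rewrite /ip -!scalemxAl mxE. Qed.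

Lemma ipBl x y z : ip (x - y) z = ip x z - ip y z.
Proof. by rewrite ipDl -scaleN1r ipZl mulN1r. Qed.

Lemma ipDr x y z : ip z (x + y) = ip z x + ip z y.
Proof. by rewrite ipC ipDl !(ipC z). Qed.

Lemma ipZr a x z : ip z (a *: x) = a * ip z x.
Proof. by rewrite ipC ipZl (ipC z). Qed.

Lemma ipBr x y z : ip z (x - y) = ip z x - ip z y.
Proof. by rewrite ipC ipBl !(ipC z). Qed.

Lemma ip_eq0 x : (ip x x == 0) = (x == 0).
Proof.
have [->|/S_pos x0] := eqVneq x 0; first by rewrite /ip !mul0mx mxE eqxx.
by rewrite gt_eqF.
Qed.

Lemma ip_normalise x : x != 0 -> ip (normalise x) (normalise x) = 1.
Proof.
move=> /S_pos x0; rewrite /normalise ipZl ipZr mulrA -expr2 exprVn.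
by rewrite sqr_sqrtr ?ltW // mulVf // gt_eqF.
Qed.

(** Removes the positive factor by which normals computed in two suitably oriented charts differ. *)
Lemma normaliseZ a x : 0 < a -> normalise (a *: x) = normalise x.
Proof.
move=> a0; rewrite /normalise ipZl ipZr mulrA -expr2 sqrtrM ?sqr_ge0 //.
rewrite sqrtr_sqr gtr0_norm // scalerA invfM mulrAC mulVf ?mul1r //.
by rewrite gt_eqF.
Qed.

Lemma mul_refl x v : x *m refl v = x - (2 / ip v v * ip x v) *: v.
Proof.
rewrite /refl mulmxBr mulmx1 -scalemxAr; congr (_ - _).
by rewrite !mulmxA ipE mul_scalar_mx scalerA.
Qed.

Lemma refl_refl v : v != 0 -> refl v *m refl v = 1%:M.
Proof.
move=> v0; apply/row_matrixP => i; rewrite !rowE mulmxA mulmx1 !mul_refl.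
have vv : ip v v != 0 by rewrite ip_eq0.
set b := ip (delta_mx 0 i) v.
have -> : 2 / ip v v * ip (delta_mx 0 i - (2 / ip v v * b) *: v) v =
    - (2 / ip v v * b) by rewrite ipBl ipZl -/b; field.
by rewrite scaleNr opprK subrK.
Qed.

Lemma refl_unit v : v != 0 -> refl v \in unitmx.
Proof. by move=> v0; have [? _] := mulmx1_unit (refl_refl v0). Qed.

Lemma refl_isometry v : v != 0 -> refl v *m S *m (refl v)^T = S.
Proof.
move=> v0; suff E : S *m (refl v)^T = refl v *m S.
  by rewrite -mulmxA E mulmxA refl_refl // mul1mx.
rewrite /refl linearB /= trmx1 linearZ /= !trmx_mul trmxK ST mulmxBl mulmxBr.
by rewrite mul1mx mulmx1 -scalemxAl -scalemxAr !mulmxA.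
Qed.

Lemma ip_refl x y v : v != 0 -> ip (x *m refl v) (y *m refl v) = ip x y.
Proof.
move=> v0; rewrite /ip trmx_mul mulmxA -[x *m _ *m S]mulmxA.
by rewrite -[x *m (_ *m S) *m _]mulmxA refl_isometry.
Qed.

Lemma refl_swap x y : ip x x = 1 -> ip y y = 1 -> x != y ->
  x *m refl (x - y) = y.
Proof.
move=> x1 y1 xy; have v0 : x - y != 0 by rewrite subr_eq0.
rewrite mul_refl.
have -> : 2 / ip (x - y) (x - y) * ip x (x - y) = 1; last first.
  by rewrite scale1r opprB addrC subrK.
have : ip (x - y) (x - y) != 0 by rewrite ip_eq0.
rewrite !ipBl !ipBr x1 y1 (ipC y x) => H.
have -> : 1 - ip x y - (ip x y - 1) = 2 * (1 - ip x y) by ring.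
have {}H : 1 - ip x y != 0.
  by apply: contra_neq H => H; rewrite -[X in _ - X]opprB H oppr0 subr0.
by field.
Qed.

Lemma posdef_unit : S \in unitmx.
Proof.
rewrite unitmxE unitfE; apply/negP => /det0P[v v0 vS].
by move: (S_pos v0); rewrite /ip vS mul0mx mxE ltxx.
Qed.

End InnerProduct.

Section SphereLift.
Variables (R : realType) (q : nat) (S : 'M[R]_(1 + q)).
Hypothesis ST : S^T = S.
Hypothesis S_pos : forall x : 'rV[R]_(1 + q), x != 0 -> 0 < ip S x x.

(** The line through [(0, z)] parallel to the first axis meets the unit sphere as soon as [(0, z)]
    lies in the unit ball. With [C] the sum of the absolute values of the entries of [S], the square
    norm of [(0, z)] is at most [rho ^ 2 * C], so [rho = (1 + C)^-1] is small enough. *)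
Lemma sphere_lift : exists2 rho : R, 0 < rho & forall z : 'rV[R]_q,
  (forall l, 0 <= z 0 l <= rho) ->
  exists2 a, ip S a a = 1 & rsubmx a = z.
Proof.
pose C := \sum_i \sum_j `|S i j|.
have C0 : 0 <= C by apply: sumr_ge0 => i _; apply: sumr_ge0.
have C1 : 0 < 1 + C by rewrite ltr_wpDr.
exists (1 + C)^-1; first by rewrite invr_gt0.
move=> z zb.
pose d : 'rV[R]_(1 + q) := row_mx 1%:M 0.
pose y : 'rV[R]_(1 + q) := row_mx 0 z.
have yb i : `|y 0 i| <= (1 + C)^-1.
  rewrite /y mxE; case: splitP => l _; first by rewrite mxE normr0 invr_ge0 ltW.
  by have /andP[z0 zr] := zb l; rewrite ger0_norm.
have d0 : d != 0.
  apply/eqP => /rowP/(_ (lshift q 0)); rewrite row_mxEl !mxE eqxx => /eqP.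
  by rewrite oner_eq0.
have yy : ip S y y <= 1.
  apply: le_trans (_ : (1 + C)^-1 * ((1 + C)^-1 * C) <= _); last first.
    have r0 : 0 <= (1 + C)^-1 by rewrite invr_ge0 ltW.
    apply: mulr_ile1; rewrite ?mulr_ge0 // ?invf_le1 ?lerDl //.
    by rewrite mulrC ler_pdivrMr // mul1r lerDr.
  rewrite /ip mxE; apply: le_trans (ler_norm _) _; apply: le_trans (ler_norm_sum _ _ _) _.
  rewrite [X in _ <= _ * (_ * X)](exchange_big _ _ _ _) /= 2!mulr_sumr.
  apply: ler_sum => j _.
  rewrite [y^T _ _]mxE [(y *m S) _ _]mxE normrM mulrC; apply: ler_pM => //.
  rewrite mulr_sumr; apply: le_trans (ler_norm_sum _ _ _) _; apply: ler_sum => i _.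
  by rewrite normrM; apply: ler_wpM2r.
pose b := ip S d y; pose al := ip S d d.
have al0 : 0 < al by exact: S_pos.
(* The larger root of the quadratic equation [ip S (t *: d + y) (t *: d + y) = 1]. *)
pose t := (Num.sqrt (b ^+ 2 + al * (1 - ip S y y)) - b) / al.
exists (t *: d + y).
  rewrite !ipDl !ipDr // !ipZl !ipZr // (ipC ST y d) -/b -/al.
  have sq : (al * t + b) ^+ 2 = b ^+ 2 + al * (1 - ip S y y).
    rewrite /t mulrC divfK ?gt_eqF // subrK sqr_sqrtr //.
    apply: addr_ge0; first exact: sqr_ge0.
    by apply: mulr_ge0; [exact: ltW|rewrite subr_ge0].
  apply: (mulfI (lt0r_neq0 al0)); rewrite mulr1.
  have -> : al * (t * (t * al) + t * b + (t * b + ip S y y)) =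
    (al * t + b) ^+ 2 - b ^+ 2 + al * ip S y y by ring.
  by rewrite sq; ring.
rewrite linearD linearZ /= /d /y !row_mxKr scaler0 add0r //.
Qed.

End SphereLift.

(** * Hyperplanes and their normals *)

Section Hypersurface.
Variables (R : realType) (k : nat) (S : 'M[R]_k.+2).
Hypothesis ST : S^T = S.
Hypothesis S_pos : forall x : 'rV[R]_k.+2, x != 0 -> 0 < ip S x x.
Implicit Types (E : 'M[R]_(k.+1, k.+2)) (x y : 'rV[R]_k.+2).

Definition border y E : 'M[R]_k.+2 := col_mx y E.

Lemma border0 y E j : border y E 0 j = y 0 j.
Proof.
have -> : (0 : 'I_k.+2) = lshift k.+1 (0 : 'I_1) by apply: val_inj.
exact: col_mxEu.
Qed.

Lemma borderS y E i j : border y E (lift 0 i) j = E i j.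
Proof.
have -> : lift 0 i = rshift 1 i :> 'I_(1 + k.+1) by apply: val_inj.
exact: col_mxEd.
Qed.

(* The generalised cross product of the rows of [E]: [det_border] says that it
   represents the functional [y |-> det (y, E)] for the inner product [S]. *)
Definition cross E : 'rV[R]_k.+2 :=
  (\row_j cofactor (border 0 E) 0 j) *m invmx S.

Lemma det_border y E : \det (border y E) = ip S y (cross E).
Proof.
rewrite (expand_det_row _ 0) /ip /cross trmx_mul trmx_inv ST mulmxA.
rewrite mulmxK ?posdef_unit // mxE; apply: eq_bigr => j _.
rewrite border0 !mxE; congr (_ * _); congr (_ * \det _).
(* Cofactors along row 0 do not see that row, so the 0 placed there by [cross] may be exchanged for
   [y]. *)
have minorE y' a c : row' 0 (col' j (border y' E)) a c = E a (lift j c).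
  by rewrite 2!mxE borderS.
by apply/matrixP => a c; rewrite !minorE.
Qed.

(** Pairing with a row of [E] gives a determinant with two equal rows. *)
Lemma cross_orth E : cross E *m S *m E^T = 0.
Proof.
apply/rowP => i; rewrite [RHS]mxE.
have -> : (cross E *m S *m E^T) 0 i = ip S (row i E) (cross E).
  by rewrite ipC // /ip tr_row colE mulmxA -colE [RHS]mxE.
rewrite -det_border.
apply: (determinant_alternate (i1 := 0) (i2 := lift 0 i)) => //.
by move=> j; rewrite border0 borderS [LHS]mxE.
Qed.

(** Pairing a linear relation with [y] kills the rows of [E] and isolates the coefficient of [y];
    freeness of [E] handles the rest. *)
Lemma border_unit y E : row_free E -> y != 0 -> y *m S *m E^T = 0 ->
  border y E \in unitmx.
Proof.
move=> fE y0 yE; rewrite unitmxE unitfE; apply/negP => /det0P[v v0 vB].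
pose v' : 'rV[R]_(1 + k.+1) := v.
have H : lsubmx v' *m y + rsubmx v' *m E = 0 by rewrite -mul_row_col hsubmxK.
have aE := mx11_scalar (lsubmx v'); rewrite aE mul_scalar_mx in H.
have Ey : E *m S *m y^T = 0.
  by apply: trmx_inj; rewrite !trmx_mul trmxK ST trmx0 mulmxA.
have := congr1 (fun r => r *m S *m y^T) H; rewrite !mulmxDl !mul0mx.
rewrite -[rsubmx v' *m E *m S]mulmxA -[rsubmx v' *m _ *m _]mulmxA Ey mulmx0 addr0.
rewrite ipE ipZl => /(congr1 (fun A : 'M[R]_(1, 1) => A 0 0)).
rewrite [LHS]mxE [RHS]mxE eqxx mulr1n => /eqP; rewrite mulf_eq0 ip_eq0 // (negPf y0) orbF.
have [l0 _|//] := eqVneq (lsubmx v' 0 0) 0.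
rewrite l0 scale0r add0r in H.
have b0 : rsubmx v' = 0 by apply: (row_free_inj fE); rewrite mul0mx.
move/eqP: v0; apply; rewrite -[LHS]/v' -(hsubmxK v') b0.
have -> : lsubmx v' = 0 by rewrite aE l0 raddf0.
by rewrite row_mx0.
Qed.

(** For dimension reasons some nonzero [y] is orthogonal to the rows of [E]; then [border y E] is
    invertible, and its determinant is the pairing of [y] with the cross product. *)
Lemma cross_neq0 E : row_free E -> cross E != 0.
Proof.
move=> fE.
have /matrix0Pn[i0 [j0 K0]] : kermx (S *m E^T) != 0.
  rewrite -mxrank_eq0 mxrank_ker -lt0n subn_gt0.
  by apply: leq_ltn_trans (rank_leq_col _) _.
have y0 : row i0 (kermx (S *m E^T)) != 0.
  by apply/eqP => /rowP/(_ j0); rewrite mxE [RHS]mxE; exact/eqP.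
have yE : row i0 (kermx (S *m E^T)) *m S *m E^T = 0.
  by rewrite -mulmxA -row_mul mulmx_ker row0.
have := border_unit fE y0 yE; rewrite unitmxE unitfE det_border.
by apply: contra_neq => ->; rewrite /ip trmx0 mulmx0 mxE.
Qed.

Lemma cross_mulmx (J : 'M[R]_k.+1) E : cross (J *m E) = \det J *: cross E.
Proof.
have bJ y : col_mx y (J *m E) = block_mx 1%:M 0 0 J *m col_mx y E.
  by rewrite mul_block_col !mul1mx !mul0mx addr0 add0r.
have dJ y : \det (border y (J *m E)) = \det J * \det (border y E).
  rewrite -[LHS]/(\det (col_mx y (J *m E) : 'M[R]_(1 + k.+1))) bJ.
  by rewrite -[LHS]/(\det (_ *m _)) det_mulmx det_ublock det1 mul1r.
suff H : cross (J *m E) *m S = (\det J *: cross E) *m S.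
  by rewrite -[LHS](mulmxK (posdef_unit S_pos)) H mulmxK ?posdef_unit.
apply/rowP => j.
have E1 x : (x *m S) 0 j = ip S (delta_mx 0 j) x.
  by rewrite (ipC ST) /ip trmx_delta -colE [RHS]mxE.
by rewrite !E1 ipZr // -!det_border dJ.
Qed.

(** The product [r] is the orthogonal projection of [x] to the row space of [E]. The difference
    [x - r] is orthogonal to [y] and to all rows of [E], that is, to the rows of an invertible
    matrix. *)
Lemma tangent_of_orth x y E : row_free E -> y != 0 -> y *m S *m E^T = 0 ->
  ip S x y = 0 -> x *m S *m E^T *m invmx (E *m S *m E^T) *m E = x.
Proof.
move=> fE y0 yE xy.
set g := E *m S *m E^T; set r := _ *m E.
have gU : g \in unitmx.
  rewrite unitmxE unitfE; apply/negP => /det0P[v v0 vg].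
  have vE0 : v *m E != 0.
    by apply: contra_neq v0 => v0; apply: (row_free_inj fE); rewrite mul0mx.
  have := S_pos vE0; rewrite /ip trmx_mul !mulmxA.
  by rewrite -[v *m E *m S]mulmxA -[v *m _ *m _]mulmxA -/g vg mul0mx mxE ltxx.
have rE : (x - r) *m S *m E^T = 0.
  rewrite !mulmxBl /r -[_ *m E *m S]mulmxA -[_ *m (E *m S) *m _]mulmxA -/g.
  by rewrite mulmxKV // subrr.
have Ey : E *m S *m y^T = 0.
  by apply: trmx_inj; rewrite !trmx_mul trmxK ST trmx0 mulmxA.
have ry : (x - r) *m S *m y^T = 0.
  rewrite !mulmxBl ipE xy /r -[_ *m E *m S]mulmxA -[_ *m (E *m S) *m _]mulmxA.
  by rewrite Ey mulmx0 subr0 raddf0.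
have bU := border_unit fE y0 yE.
have : (x - r) *m S *m (border y E)^T = 0.
  have -> : (border y E)^T = row_mx y^T E^T by exact: (@tr_col_mx _ 1 k.+1 k.+2).
  rewrite (@mul_mx_row _ 1 k.+2 1 k.+1) rE ry; exact: (@row_mx0 _ 1 1 k.+1).
move=> H; apply/eqP; rewrite eq_sym -subr_eq0; apply/eqP.
have := congr1 (fun A => A *m invmx (border y E)^T *m invmx S) H.
by rewrite mulmxK ?unitmx_tr // mulmxK ?posdef_unit // !mul0mx.
Qed.

Lemma orth_basis (a : 'rV[R]_k.+2) : a != 0 ->
  exists2 B : 'M[R]_(k.+1, k.+2), row_free B & B *m S *m a^T = 0.
Proof.
move=> a0; have SU := posdef_unit S_pos.
have rk : \rank (kermx (S *m a^T)) = k.+1.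
  rewrite mxrank_ker -mxrank_tr trmx_mul trmxK ST.
  have -> : \rank (a *m S) = 1%N.
    rewrite mxrankMfree ?rank_rV ?a0 // row_free_unit //.
  by rewrite subn1.
have [B BE] : exists B : 'M[R]_(k.+1, k.+2), (B :=: kermx (S *m a^T))%MS.
  move: (eq_row_base (kermx (S *m a^T))); move: (row_base _).
  by rewrite rk => B BE; exists B.
exists B; first by rewrite /row_free BE rk.
by apply/eqP; rewrite -mulmxA -sub_kermx BE.
Qed.

End Hypersurface.

(** * Hypersurfaces and their foliations *)

Section SmoothInner.
Variables (R : realType) (n : nat) (S : 'M[R]_n).
Hypothesis S_pos : forall x : 'rV[R]_n, x != 0 -> 0 < ip S x x.
Variables (V : normedModType R) (U : set V).
Hypothesis oU : open U.

Lemma smooth_on_ip (x y : V -> 'rV[R]_n) : smooth_on U x -> smooth_on U y ->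
  smooth_on U (fun u => ip S (x u) (y u)).
Proof.
move=> sx sy; apply: (@smooth_on_coord _ _ _ _ U (fun u => x u *m S *m (y u)^T)) => //.
apply: smooth_on_mulmx => //; last exact: smooth_on_trmx.
by apply: smooth_on_mulmx => //; exact: smooth_on_cst.
Qed.

Lemma smooth_on_normalise (x : V -> 'rV[R]_n) :
  (forall u, U u -> x u != 0) -> smooth_on U x ->
  smooth_on U (fun u => normalise S (x u)).
Proof.
move=> x0 sx; apply: smooth_on_scale => //; apply: smooth_onV => //.
  by move=> u /x0/S_pos xu; rewrite gt_eqF // sqrtr_gt0.
apply: smooth_on_sqrt => //; first by move=> u /x0/S_pos.
exact: smooth_on_ip.
Qed.

Lemma smooth_on_refl (v : V -> 'rV[R]_n) :
  (forall u, U u -> v u != 0) -> smooth_on U v ->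
  smooth_on U (fun u => refl S (v u)).
Proof.
move=> v0 sv.
apply: (@smooth_on_ext _ _ _ U (fun u => 1%:M +
    (- 2 * (ip S (v u) (v u))^-1) *: (S *m (v u)^T *m v u))) => //.
  by move=> u _; rewrite /refl mulNr scaleNr.
apply: smooth_onD => //; first exact: smooth_on_cst.
apply: smooth_on_scale => //.
  move=> l; apply: Ck_onM => //; first exact: Ck_on_cst.
  apply: smooth_onV => //; first by move=> u /v0/S_pos vu; rewrite gt_eqF.
  exact: smooth_on_ip.
apply: smooth_on_mulmx => //; apply: smooth_on_mulmx => //.
  exact: smooth_on_cst.
exact: smooth_on_trmx.
Qed.

End SmoothInner.

(** The local formulas need to agree only on a subatlas [O], since those for the two normals are
    invariant only under oriented, respectively transversely oriented, changes of charts. *)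
Lemma glue_smooth (R : realType) (T : topologicalType) (m q : nat)
    (A : smooth_manifold R T m) (O : set (chart R T m))
    (loc : chart R T m -> 'rV[R]_m -> 'rV[R]_q) :
  O `<=` atlas A -> (forall p, exists2 c, O c & dom c p) ->
  (forall c, O c -> smooth_on (cod c) (loc c)) ->
  (forall c d u, O c -> O d -> overlap c d u ->
     loc c u = loc d (transition c d u)) ->
  exists2 h, smooth_fun A h &
    forall c u, O c -> cod c u -> h (param c u) = loc c u.
Proof.
move=> OA cover sloc compat.
have [ch chP] := choice (fun p => let: ex_intro2 c Oc cp := cover p in
  ex_intro (fun c => O c /\ dom c p) c (conj Oc cp)).
pose h p := loc (ch p) (coord (ch p) p).
have hE c u : O c -> cod c u -> h (param c u) = loc c u.
  move=> Oc cu; have [Od du] := chP (param c u).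
  by rewrite (compat c (ch (param c u)) u).
exists h => //; apply: smooth_fun_local => p.
have [c Oc cp] := cover p.
exists c, (cod c); split=> //.
- exact: OA.
- exact: open_cod.
- exact: coord_cod.
apply: smooth_on_ext (sloc c Oc); first exact: open_cod.
by move=> u cu; rewrite /= hE.
Qed.

Section Foliated.
Variables (R : realType) (T : topologicalType) (k : nat).
Variables (A : smooth_manifold R T k.+1) (F : foliation A).

Lemma foliated_jacobian c d u i :
  foliated_charts F c -> foliated_charts F d -> overlap c d u ->
  i != ord_max -> 'J (transition c d) u i ord_max = 0.
Proof.
move=> Fc Fd ov iN.
have dt := transition_differentiable (foliated_sub Fc) (foliated_sub Fd) ov.
have [h hE] := foliated_compatible Fc Fd ov.
apply: etrans (jacobianE i ord_max dt) _.
rewrite (derive_mxE _ _ _ dt).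
apply: etrans (near_eq_derive _ hE) _.
apply: derive_constant_line => s; congr h.
by rewrite !mxE eqxx /= eq_sym (negPf iN) mulr0 add0r.
Qed.

Lemma foliated_tangent c u i : foliated_charts F c -> i != ord_max ->
  tangent_to_leaf F c u (delta_mx 0 i).
Proof.
move=> Fc iN d Fd ov; rewrite -rowE [LHS]mxE.
exact: foliated_jacobian.
Qed.

End Foliated.

Section Hypersurfaces.
Variables (R : realType) (k : nat) (G : topologicalZmodType).
Variables (AG : smooth_manifold R G k.+2) (gG : riemannian_metric AG).
Hypotheses (LG : commutative_lie_group AG) (lG : left_invariant gG).
Variable e : chart R G k.+2.
Hypotheses (ae : atlas AG e) (e0 : dom e 0).
Variables (M : topologicalType) (AM : smooth_manifold R M k.+1).
Variables (gM : riemannian_metric AM) (f : M -> G).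
Hypotheses (sf : smooth_map AM AG f) (iso : isometric gM gG f).

Local Notation E := (frame e f).
Local Notation S := (gG e (coord e 0)).

Let ez0 : cod e (coord e 0).
Proof. exact: coord_cod. Qed.

Lemma origin_gram_sym : S^T = S.
Proof. exact: gram_sym. Qed.

Lemma origin_gram_pos (x : 'rV[R]_k.+2) : x != 0 -> 0 < ip S x x.
Proof. exact: gram_posdef. Qed.

Local Notation ST := origin_gram_sym.
Local Notation SP := origin_gram_pos.

Lemma gram_frame c u : atlas AM c -> cod c u ->
  gM c u = E c u *m S *m (E c u)^T.
Proof. by move=> ac cu; exact: (frame_metric LG ae e0 sf lG iso). Qed.

Lemma gram_unit c u : atlas AM c -> cod c u -> gM c u \in unitmx.
Proof.
by move=> ac cu; apply: posdef_unit => x x0; exact: gram_posdef.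
Qed.

Lemma frame_free c u : atlas AM c -> cod c u -> row_free (E c u).
Proof.
move=> ac cu; rewrite /row_free eqn_leq rank_leq_row /=.
have := gram_unit ac cu; rewrite -row_free_unit /row_free => /eqP {1}<-.
by rewrite gram_frame // -mulmxA mxrankM_maxl.
Qed.

(* The components in the chart [c] of the tangential part of the translated
   vector [h]. *)
Definition components (h : M -> 'rV[R]_k.+2) c (u : 'rV[R]_k.+1) : 'rV[R]_k.+1 :=
  h (param c u) *m S *m (E c u)^T *m invmx (gM c u).

Definition tangent (h : M -> 'rV[R]_k.+2) : Prop := forall c u,
  atlas AM c -> cod c u -> components h c u *m E c u = h (param c u).

Lemma tangent_orth (h eta : M -> 'rV[R]_k.+2) :
  (forall c u, atlas AM c -> cod c u ->
     eta (param c u) != 0 /\ eta (param c u) *m S *m (E c u)^T = 0) ->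
  (forall p, ip S (h p) (eta p) = 0) -> tangent h.
Proof.
move=> etaP heta c u ac cu; have [eta0 etaE] := etaP c u ac cu.
rewrite /components gram_frame //.
by apply: (tangent_of_orth ST SP (frame_free ac cu) eta0 etaE).
Qed.

Lemma components_vector_field h : smooth_fun AM h -> tangent h ->
  vector_field AM setT (components h).
Proof.
move=> sh th; split=> [c ac|c d u ac ad ov _].
  apply: (@smooth_on_sub _ _ _ (cod c)) => [u [] //|].
  have oc := open_cod (c := c).
  apply: smooth_on_mulmx => //.
    apply: smooth_on_mulmx => //; last first.
      by apply: smooth_on_trmx => //; exact: (frame_smooth LG ae e0 sf ac).
    apply: smooth_on_mulmx => //; first exact: sh.
    exact: smooth_on_cst.
  apply: smooth_on_invmx => //; first by move=> u; exact: gram_unit.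
  exact: gram_smooth.
have [[dt _] pt _] := overlap_transition ov; have [cu _] := ov.
apply: (row_free_inj (frame_free ad dt)); rewrite (th d) // -mulmxA.
by rewrite -(frame_change LG ae e0 sf ac ad ov) (th c) // pt.
Qed.

Lemma components_inner h c u (X : 'rV[R]_k.+1) : tangent h ->
  atlas AM c -> cod c u ->
  inner gM c u (components h c u) X = ip S (h (param c u)) (X *m E c u).
Proof.
move=> th ac cu; rewrite /inner /ip gram_frame // trmx_mul !mulmxA.
by rewrite (th c u ac cu).
Qed.

Lemma exists_normal (oM : orientation AM) : exists2 eta : M -> 'rV[R]_k.+2,
  smooth_fun AM eta & forall c u, atlas AM c -> cod c u ->
    ip S (eta (param c u)) (eta (param c u)) = 1 /\
    eta (param c u) *m S *m (E c u)^T = 0.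
Proof.
have sub := @oriented_sub _ _ _ _ oM.
have [||c d u Oc Od ov|eta seta etaE] := @glue_smooth R M k.+1 k.+2 AM
    (oriented_charts oM) (fun c u => normalise S (cross S (E c u))) sub.
- exact: oriented_cover.
- move=> c /sub ac; have oc := open_cod (c := c).
  apply: smooth_on_normalise => //; first exact: SP.
    by move=> u cu; apply: (cross_neq0 ST SP); exact: frame_free.
  apply: smooth_on_mulmx => //; last exact: smooth_on_cst.
  apply: smooth_on_mx => // i j.
  apply: (@smooth_on_ext _ _ _ _ (fun u => cofactor (border 0 (E c u)) 0 j)) => //.
    by move=> u _; rewrite [RHS]mxE.
  apply: smooth_on_cofactor => //; apply: smooth_on_mx => // a b.
  case: (unliftP 0 a) => [a'|] ->.
    apply: (@smooth_on_ext _ _ _ _ (fun u => E c u a' b)) => //.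
      by move=> u _; rewrite borderS.
    by apply: smooth_on_coord => //; exact: (frame_smooth LG ae e0 sf ac).
  apply: (@smooth_on_ext _ _ _ _ (fun=> 0)) => //; last exact: smooth_on_cst.
  by move=> u _; rewrite border0 mxE.
- rewrite (frame_change LG ae e0 sf (sub _ Oc) (sub _ Od) ov).
  rewrite (cross_mulmx ST SP) (normaliseZ ST) //.
  exact: (oriented_det Oc Od ov).
exists eta => // c u ac cu.
have [d Od dp] := oriented_cover oM (param c u).
have ov : overlap c d u by [].
have [[dt _] pt _] := overlap_transition ov; have ad := sub _ Od.
rewrite -pt (etaE d) //; split.
  apply: (ip_normalise ST SP); apply: (cross_neq0 ST SP); exact: frame_free.
rewrite (frame_change LG ae e0 sf ac ad ov) trmx_mul /normalise -!scalemxAl.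
by rewrite mulmxA (cross_orth ST SP) mul0mx scaler0.
Qed.

Section FoliationNormal.
Variable F : foliation AM.
Variable O : set (chart R M k.+1).
Hypothesis OF : O `<=` foliated_charts F.
Hypothesis O_cover : forall p, exists2 c, O c & dom c p.
Hypothesis O_pos : forall c d u, O c -> O d -> overlap c d u ->
  0 < 'J (transition c d) u ord_max ord_max.

Let OA c : O c -> atlas AM c.
Proof. by move=> /OF/foliated_sub. Qed.

(* The gradient of the transverse coordinate of a foliated chart. *)
Let nu c u : 'rV[R]_k.+2 := delta_mx 0 ord_max *m invmx (gM c u) *m E c u.

Let nu_neq0 c u : O c -> cod c u -> nu c u != 0.
Proof.
move=> Oc cu; have ac := OA Oc; apply/eqP => nu0.
have : delta_mx 0 ord_max *m invmx (gM c u) = 0 :> 'rV[R]_k.+1.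
  by apply: (row_free_inj (frame_free ac cu)); rewrite mul0mx.
move=> /(congr1 (fun A => A *m gM c u)); rewrite mulmxKV ?gram_unit // mul0mx.
by move=> /rowP/(_ ord_max); rewrite !mxE !eqxx => /eqP; rewrite oner_eq0.
Qed.

(** If the transverse coordinates are related by [h], their gradients differ by the factor [h'],
    which the transverse orientation makes positive. *)
Let nu_change c d u : O c -> O d -> overlap c d u ->
  nu c u = ('J (transition c d) u ord_max ord_max)^-1 *:
           nu d (transition c d u).
Proof.
move=> Oc Od ov; have [ac ad] := (OA Oc, OA Od).
have [[dt _] _ _] := overlap_transition ov; have [cu _] := ov.
have J0 := O_pos Oc Od ov.
have Jlast : delta_mx 0 ord_max *m ('J (transition c d) u)^T =
    'J (transition c d) u ord_max ord_max *: (delta_mx 0 ord_max : 'rV[R]_k.+1).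
  apply/rowP => i; rewrite -rowE [LHS]mxE [LHS]mxE [RHS]mxE.
  have -> : (delta_mx 0 ord_max : 'rV[R]_k.+1) 0 i = (i == ord_max)%:R.
    by rewrite mxE eqxx.
  have [->|iN] := eqVneq i ord_max; first by rewrite mulr1.
  by rewrite mulr0; exact: (foliated_jacobian (OF Oc) (OF Od) ov iN).
have Ju := jacobian_transition_unit ac ad ov.
have gd := gram_unit ad dt.
rewrite /nu (frame_change LG ae e0 sf ac ad ov) mulmxA scalemxAl.
congr (_ *m _).
have gJ : gM d (transition c d u) *m ('J (transition c d) u)^T \in unitmx.
  by rewrite unitmx_mul gd unitmx_tr.
rewrite -[LHS](mulmxK gJ) -[RHS](mulmxK gJ); congr (_ *m _).
rewrite !mulmxA -[_ *m 'J _ _ *m gM _ _]mulmxA -[_ *m (_ *m gM _ _) *m _]mulmxA.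
rewrite -(gram_change gM ac ad ov) mulmxKV ?gram_unit //.
rewrite -!scalemxAl mulmxKV // Jlast scalerA mulVf ?scale1r //.
by rewrite gt_eqF.
Qed.

Lemma exists_foliation_normal : exists2 N : M -> 'rV[R]_k.+2,
  smooth_fun AM N & [/\ forall p, ip S (N p) (N p) = 1, tangent N &
    unit_normal_field gM F setT (components N)].
Proof.
have [||c d u Oc Od ov|N sN NE] := @glue_smooth R M k.+1 k.+2 AM O
    (fun c u => normalise S (nu c u)) OA.
- exact: O_cover.
- move=> c Oc; have oc := open_cod (c := c); have ac := OA Oc.
  apply: smooth_on_normalise => //; first exact: SP.
    by move=> u cu; exact: nu_neq0.
  apply: smooth_on_mulmx => //; last exact: (frame_smooth LG ae e0 sf ac).
  apply: smooth_on_mulmx => //; first exact: smooth_on_cst.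
  apply: smooth_on_invmx => //; first by move=> u; exact: gram_unit.
  exact: gram_smooth.
- rewrite (nu_change Oc Od ov) (normaliseZ ST) // invr_gt0.
  exact: O_pos.
have N1 p : ip S (N p) (N p) = 1.
  have [c Oc cp] := O_cover p; rewrite -(coordK cp) NE //; last exact: coord_cod.
  by apply: (ip_normalise ST SP); apply: nu_neq0 => //; exact: coord_cod.
have NO c u : O c -> cod c u -> exists X : 'rV[R]_k.+1, N (param c u) = X *m E c u.
  move=> Oc cu; rewrite NE // /normalise /nu scalemxAl.
  by eexists.
have tN : tangent N.
  move=> c u ac cu; have [d Od dp] := O_cover (param c u).
  have ov : overlap c d u by [].
  have [[dt _] pt _] := overlap_transition ov; have ad := OA Od.
  have [X XE] := NO d _ Od dt.
  have [Y YE] : exists Y, N (param c u) = Y *m E c u.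
    exists (X *m invmx ('J (transition c d) u)).
    rewrite (frame_change LG ae e0 sf ac ad ov) mulmxA mulmxKV.
      by rewrite -XE pt.
    exact: (jacobian_transition_unit ac ad ov).
  rewrite /components YE -[Y *m E c u *m S]mulmxA.
  rewrite -[Y *m (E c u *m S) *m _]mulmxA -(gram_frame ac cu).
  exact: (congr1 (fun A => A *m E c u) (mulmxK (gram_unit ac cu) Y)).
exists N => //; split=> //; split; first exact: components_vector_field.
move=> c u ac cu _; split.
  by rewrite components_inner // (tN c u ac cu) N1.
move=> X tX; rewrite components_inner //.
have [d Od dp] := O_cover (param c u).
have ov : overlap c d u by [].
have [[dt _] pt _] := overlap_transition ov; have ad := OA Od.
have X0 := tX d (OF Od) ov.
rewrite (frame_change LG ae e0 sf ac ad ov) mulmxA -pt NE // /normalise ipZl.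
set Y := X *m _ in X0 *.
(* Pairing with the gradient of the transverse coordinate reads off the transverse component, which
   is 0 for a vector tangent to the leaf. *)
have -> : ip S (nu d (transition c d u)) (Y *m E d (transition c d u)) = Y 0 ord_max.
  move: (transition c d u) dt Y {X0 pt} => v dv Y.
  rewrite /ip /nu trmx_mul mulmxA.
  rewrite -[delta_mx 0 ord_max *m _ *m E d v *m S]mulmxA.
  rewrite -[delta_mx 0 ord_max *m _ *m (E d v *m S) *m _]mulmxA.
  rewrite -(gram_frame ad dv) (mulmxKV (gram_unit ad dv)) -rowE.
  by rewrite [LHS]mxE [LHS]mxE.
by rewrite X0 mulr0.
Qed.

End FoliationNormal.

Section UnitTangentField.
Variable N : M -> 'rV[R]_k.+2.
Hypotheses (sN : smooth_fun AM N) (tN : tangent N).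
Hypothesis N1 : forall p, ip S (N p) (N p) = 1.

Lemma unit_neq0 (x : 'rV[R]_k.+2) : ip S x x = 1 -> x != 0.
Proof. by move=> x1; rewrite -(ip_eq0 SP) x1 oner_eq0. Qed.

Lemma parallelisable_curve : k = 0%N -> parallelisable AM.
Proof.
move=> k0; exists (fun=> components N); split=> [i|c u ac cu].
  exact: (components_vector_field sN tN).
have row0E : (\matrix_(i < k.+1) components N c u) != 0.
  apply/eqP => /row_matrixP/(_ ord0); rewrite rowK row0 => c0.
  have := tN ac cu; rewrite c0 mul0mx => /eqP; rewrite eq_sym.
  exact/negP/unit_neq0.
rewrite /row_free eqn_leq rank_leq_row /=.
apply: leq_ltn_trans (_ : (k <= 0)%N) _; first by rewrite k0.
by rewrite lt0n mxrank_eq0.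
Qed.

Section Normals.
Variables (eta : M -> 'rV[R]_k.+2) (a : 'rV[R]_k.+2).
Hypothesis seta : smooth_fun AM eta.
Hypothesis etaP : forall c u, atlas AM c -> cod c u ->
  ip S (eta (param c u)) (eta (param c u)) = 1 /\
  eta (param c u) *m S *m (E c u)^T = 0.
Hypothesis a1 : ip S a a = 1.
Hypothesis Na : forall p, N p <> a.

Let in_chart (P : M -> Prop) :
  (forall c u, atlas AM c -> cod c u -> P (param c u)) -> forall p, P p.
Proof.
move=> H p; have [c ac cp] := atlas_cover AM p.
by rewrite -(coordK cp); apply: H => //; exact: coord_cod.
Qed.

Let eta1 p : ip S (eta p) (eta p) = 1.
Proof. by move: p; apply: in_chart => c u ac cu; have [] := etaP ac cu. Qed.

Let N_eta p : ip S (eta p) (N p) = 0.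
Proof.
move: p; apply: in_chart => c u ac cu; have [_ etaE] := etaP ac cu.
by rewrite -(tN ac cu) /ip trmx_mul mulmxA etaE mul0mx mxE.
Qed.

Let N_sub_a p : N p - a != 0.
Proof. by rewrite subr_eq0; apply/eqP; exact: Na. Qed.

Let N_sub_eta p : N p - eta p != 0.
Proof.
rewrite subr_eq0; apply/eqP => NE; have := N_eta p.
by rewrite NE eta1 => /eqP; rewrite oner_eq0.
Qed.

(* A reflection takes [a] to [N p] and another one [N p] to [eta p], so that
   their product takes the constant space orthogonal to [a] to the tangent
   space, which is orthogonal to [eta p]. *)
Let turn p : 'M[R]_k.+2 := refl S (N p - a) *m refl S (N p - eta p).

Let turn_a p : a *m turn p = eta p.
Proof.
have Ea : N p *m refl S (N p - a) = a.
  by apply: (refl_swap ST SP) => //; apply/eqP; exact: Na.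
rewrite /turn mulmxA -{1}Ea -[N p *m _ *m _]mulmxA (refl_refl SP) // mulmx1.
by apply: (refl_swap ST SP) => //; rewrite -subr_eq0; exact: N_sub_eta.
Qed.

Let turn_isometry p (x y : 'rV[R]_k.+2) :
  ip S (x *m turn p) (y *m turn p) = ip S x y.
Proof. by rewrite /turn !mulmxA !(ip_refl ST SP). Qed.

Lemma parallelisable_of_normals : parallelisable AM.
Proof.
have [B fB Ba] := orth_basis ST SP (unit_neq0 a1).
pose X i p := row i B *m turn p.
have sX i : smooth_fun AM (X i).
  move=> c ac; have oc := open_cod (c := c).
  have sub (h : M -> 'rV[R]_k.+2) : smooth_fun AM h ->
      smooth_on (cod c) (fun u => N (param c u) - h (param c u)).
    move=> sh; apply: smooth_onD => //; first exact: sN.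
    apply: (@smooth_on_ext _ _ _ _ (fun u => (-1) *: h (param c u))) => //.
      by move=> u _; rewrite scaleN1r.
    by apply: smooth_on_scale => //; [exact: smooth_on_cst|exact: sh].
  apply: smooth_on_mulmx => //; first exact: smooth_on_cst.
  apply: smooth_on_mulmx => //; apply: smooth_on_refl => //.
  - exact: SP.
  - by apply: (sub (fun=> a)) => d _; exact: smooth_on_cst.
  - exact: SP.
  - exact: sub.
have tX i : tangent (X i).
  apply: (tangent_orth (eta := eta)) => [c u ac cu|p].
    by have [e1 eE] := etaP ac cu; split=> //; exact: unit_neq0.
  (* Writing [eta p] as the image of [a] under the isometry [turn p] leaves the orthogonality of [a]
     to the rows of [B]. *)
  rewrite -turn_a turn_isometry /ip.
  by rewrite -!row_mul Ba row0 mxE.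
exists (fun i => components (X i)); split=> [i|c u ac cu].
  exact: (components_vector_field (sX i) (tX i)).
set W := \matrix_i _.
have WE : W *m E c u = B *m turn (param c u).
  apply/row_matrixP => i; rewrite !row_mul rowK.
  exact: (tX i c u ac cu).
have tU : turn (param c u) \in unitmx.
  by rewrite unitmx_mul !(refl_unit SP).
rewrite /row_free eqn_leq rank_leq_row /=.
have rk : \rank (W *m E c u) = k.+1.
  by rewrite WE mxrankMfree ?row_free_unit //; apply/eqP.
by apply: leq_trans (mxrankM_maxl W (E c u)); rewrite rk.
Qed.

End Normals.

Section Geodesic.
Variable F : foliation AM.
Hypothesis nN : unit_normal_field gM F setT (components N).
Hypothesis geo : totally_geodesic_leaves gM F.

(* Along the leaves the tangential part of the derivative of [N] is the
   covariant derivative, hence zero; so the derivative of [N] along a leaf is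
   normal to the hypersurface, and only one direction is left. *)
Lemma rank_gauss c u : foliated_charts F c -> cod c u ->
  (\rank ('J (N \o param c) u) <= 2)%N.
Proof.
move=> Fc cu; have ac := foliated_sub Fc.
have dN : differentiable (N \o param c) u.
  exact: (smooth_on_differentiable (sN ac) cu).
have gU := gram_unit ac cu.
have leaf i : i != ord_max ->
    'D_(delta_mx 0 i) (N \o param c) u *m (S *m (E c u)^T) = 0.
  move=> iN.
  have := geo openT nN ac cu I (foliated_tangent Fc iN).
  rewrite /shape_operator => /eqP; rewrite oppr_eq0 => /eqP.
  have gE : \forall v \near u, gM c v = E c v *m S *m (E c v)^T.
    apply: near_open (@open_cod _ _ _ c) cu _ => v cv.
    exact: (gram_frame).
  have dE := smooth_on_differentiable (frame_smooth LG ae e0 sf ac) cu.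
  have dC : differentiable (components N c) u.
    have [[sC _] _] := nN.
    by apply: (smooth_on_differentiable (sC c ac)).
  rewrite (covariant_derivative_frame gE ST dE
    (fun i j => frame_closed LG ae e0 sf i j ac cu) gU _ dC).
  have nE : \forall v \near u, components N c v *m E c v = (N \o param c) v.
    by apply: near_open (@open_cod _ _ _ c) cu _ => v cv; exact: tN.
  rewrite (near_eq_derive _ nE) => H.
  by rewrite mulmxA -[LHS](mulmxKV gU) H mul0mx.
have sub : ('J (N \o param c) u <=
    kermx (S *m (E c u)^T) + row ord_max ('J (N \o param c) u))%MS.
  apply/row_subP => i; have [->|iN] := eqVneq i ord_max; first exact: addsmxSr.
  apply: submx_trans (addsmxSl _ _).
  rewrite (row_jacobian i dN); apply/sub_kermxP; exact: leaf.
apply: leq_trans (mxrankS sub) _.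
apply: leq_trans (mxrank_adds_leqif _ _) _.
apply: (@leq_add _ _ 1 1); last exact: rank_leq_row.
have SU : row_free S by rewrite row_free_unit; exact: (posdef_unit SP).
rewrite mxrank_ker -mxrank_tr trmx_mul trmxK ST mxrankMfree //.
have /eqP -> := frame_free ac cu.
by rewrite subSnn.
Qed.

(** [P] forgets the first coordinate, which makes source and target equidimensional. An invertible
    Jacobian of the projected map would have rank [k.+1], at least 3, against [rank_gauss]. A lift
    [a] of the value missed by the projection is missed by [N]. *)
Lemma gauss_misses_point : (1 < k)%N -> compact [set: M] ->
  exists2 a, ip S a a = 1 & forall p, N p <> a.
Proof.
move=> k1 cM.
have [rho rho0 lift] := @sphere_lift R k.+1 S ST SP.
pose P : 'M[R]_(k.+2, k.+1) := col_mx (0 : 'M[R]_(1, k.+1)) 1%:M.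
have PE (v : 'rV[R]_k.+2) : v *m P = rsubmx (v : 'rV[R]_(1 + k.+1)).
  rewrite -[v in LHS](hsubmxK (v : 'rV[R]_(1 + k.+1))) /P.
  by rewrite (@mul_row_col _ 1 1 k.+1 k.+1) mulmx0 add0r mulmx1.
have [|z [zb zN]] := @mini_sard R M k (fun p => N p *m P) cM _ rho rho0.
  move=> p; have [c Fc cp] := foliated_cover F p; have ac := foliated_sub Fc.
  have oc := open_cod (c := c).
  have /nbhs_ballP[r /= r0 rc] : nbhs (coord c p) (cod c).
    by apply: open_nbhs_nbhs; split=> //; exact: coord_cod.
  (* Half the radius, so that the closed ball still lies in the open ball contained in [cod c]. *)
  exists (coord c p), (r / 2), (param c), (cod c); split=> //=.
  - have n1 : nbhs p (dom c) by apply: open_nbhs_nbhs; split=> //; exact: open_dom.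
    have n2 : nbhs p (coord c @^-1` ball (coord c p) (r / 2)).
      by apply: (coord_continuous cp); apply: nbhsx_ballx; rewrite divr_gt0.
    apply: filterS (filterI n1 n2) => q [cq bq].
    exists (coord c q); last by rewrite coordK.
    by move: bq; rewrite /= -ball_normE /= distrC => /ltW.
  - move=> u Ku; apply: rc; rewrite -ball_normE /= distrC.
    by apply: le_lt_trans Ku _; rewrite ltr_pdivrMr // ltr_pMr // ltr1n.
  - have sP : smooth_on (cod c) (fun u => (N \o param c) u *m P).
      by apply: smooth_on_mulmx => //; [exact: sN|exact: smooth_on_cst].
    exact: (sP 1%N).
  - move=> u Ku; have cu : cod c u.
      apply: rc; rewrite -ball_normE /= distrC.
      by apply: le_lt_trans Ku _; rewrite ltr_pdivrMr // ltr_pMr // ltr1n.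
    have dN : differentiable (N \o param c) u.
      exact: (smooth_on_differentiable (sN ac) cu).
    have dP : differentiable (fun=> P : 'M[R]_(k.+2, k.+1)) u.
      exact: differentiable_cst.
    have JE : 'J ((fun p => N p *m P) \o param c) u = 'J (N \o param c) u *m P.
      have dNP := differentiable_mulmx dN dP.
      apply/row_matrixP => i; apply: etrans (row_jacobian i dNP) _.
      rewrite (derive_mulmx _ dN dP) derive_cst mulmx0 addr0 row_mul.
      by rewrite (row_jacobian i dN).
    rewrite JE; apply/eqP; apply: contraLR k1 => dJ.
    have Ju : 'J (N \o param c) u *m P \in unitmx by rewrite unitmxE unitfE.
    move: Ju; rewrite -row_free_unit /row_free => /eqP rk.
    rewrite -leqNgt -ltnS -{1}rk; apply: leq_trans (mxrankM_maxl _ _) _.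
    exact: rank_gauss.
have [a a1 az] := lift z zb; exists a => // p Np.
by apply: (zN p); rewrite PE Np.
Qed.

End Geodesic.

End UnitTangentField.

End Hypersurfaces.

Theorem corollary4p5 (R : realType) (n : nat)
    (G : topologicalZmodType) (AG : smooth_manifold R G (2 * n).+2)
    (gG : riemannian_metric AG)
    (M : topologicalType) (AM : smooth_manifold R M (2 * n).+1)
    (oM : orientation AM) (gM : riemannian_metric AM) (f : M -> G) :
  commutative_lie_group AG ->
  left_invariant gG ->
  compact [set: M]%classic ->
  connected [set: M]%classic ->
  immersion AM AG f ->
  isometric gM gG f ->
  ~ parallelisable AM ->
  ~ (exists F : foliation AM,
       transversely_orientable F /\ totally_geodesic_leaves gM F).
Proof.
move=> LG lG cM _ [sf _] iso nP [F [to geo]]; apply: nP.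
have [ch [chF ch_cover ch_pos]] := to.
have [e ae e0] := atlas_cover AG 0.
have [N sN [N1 tN nN]] :=
  exists_foliation_normal LG lG ae e0 sf iso chF ch_cover ch_pos.
have [n0|n_gt0] := posnP n.
  by apply: (parallelisable_curve LG lG ae e0 sf iso sN tN N1); rewrite n0.
(* The odd dimension of [M] rules out surfaces, for which a rank of at most 2 would carry no
   information. *)
have k1 : (1 < 2 * n)%N by lia.
have [a a1 Na] :=
  gauss_misses_point LG lG ae e0 sf iso sN tN nN geo k1 cM.
have [eta seta etaP] := exists_normal LG lG ae e0 sf iso oM.
exact: (parallelisable_of_normals LG lG ae e0 sf iso sN tN N1 seta etaP a1 Na).
Qed.
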